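(* Let $L\subset(M^4,J)$ be a pseudoholomorphic curve in an almost complex manifold of real dimension $4$. Existence of a pseudoholomorphic foliation $\mathcal H$ of a neighborhood of $L$, having $L$ as a leaf, with pseudoholomorphic transports is a condition of codimension infinity on $J$.
   Context: A surface $L\subset(M,J)$ is a pseudoholomorphic (PH) curve if $TL$ is $J$-invariant; a foliation by surfaces is pseudoholomorphic if all its leaves are PH-curves. A small neighborhood of $L$ can be foliated by PH-disks $D^2_z$ transversal to $L$ at $z\in L$. Let $\mathcal H$ be a PH-foliation of a neighborhood of $L$ with $L$ as a leaf. A path in $L$ between $z_1,z_2\in L$ determines a (germ of a) map $D^2_{z_1}\to D^2_{z_2}$ by shifts along the leaves of $\mathcal H$, called the transport. $\mathcal H$ has pseudoholomorphic transports if all these maps are pseudoholomorphic; this requirement is independent of the choice of the family of transversal PH-disks (so it means that the local projections along $\mathcal H$ are pseudoholomorphic). A condition on almost complex structures $J$ (with $L$ pseudoholomorphic) is of codimension infinity if, for $x\in L$, the $m$-jets at $x$ of structures satisfying it are contained in subsets of the space of all $m$-jets at $x$ of such structures whose codimension tends to infinity as $m\to\infty$. *)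

(* Defs.v *)
(* MathComp / MathComp-Analysis, over an arbitrary R : realType. *)
From HB Require Import structures.
From mathcomp Require Import all_boot all_order all_algebra.
From mathcomp Require Import all_classical all_reals all_analysis.

Set Implicit Arguments.
Unset Strict Implicit.
Unset Printing Implicit Defensive.

Import Order.TTheory GRing.Theory Num.Theory numFieldNormedType.Exports.

Local Open Scope classical_set_scope.
Local Open Scope ring_scope.

(* Meant for open U, as all uses below are. *)
Fixpoint Ck (R : realType) (E F : normedModType R) (k : nat) (U : set E)
    (f : E -> F) : Prop :=
  match k with
  | 0 => forall x, U x -> {for x, continuous f}
  | k'.+1 => (forall x, U x -> differentiable f x) /\
             forall v, Ck k' U (fun x => 'd f x v)
  end.

Definition smooth_on (R : realType) (E F : normedModType R) (U : set E)
    (f : E -> F) : Prop := forall k, Ck k U f.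

(* The model space is R^2 x R^2: usubmx gives the coordinates along a surface
   (or leaf) and dsubmx the transverse ones.  The values of crd outside dom and
   of par outside crd @` dom are irrelevant. *)
Record chart (R : realType) (M : topologicalType) := Chart {
  dom : set M ;
  crd :> M -> 'cV[R]_(2 + 2) ;
  par : 'cV[R]_(2 + 2) -> M ;
  dom_open : open dom ;
  img_open : open (crd @` dom) ;
  crdK : forall p, dom p -> par (crd p) = p ;
  crd_continuous : forall p, dom p -> {for p, continuous crd} ;
  par_continuous : forall y, (crd @` dom) y -> {for y, continuous par} }.

Definition transition (R : realType) (M : topologicalType)
    (phi psi : chart R M) : 'cV[R]_(2 + 2) -> 'cV[R]_(2 + 2) :=
  fun y => psi (par phi y).

Definition compatible (R : realType) (M : topologicalType)
    (phi psi : chart R M) : Prop :=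
  smooth_on (phi @` (dom phi `&` dom psi)) (transition phi psi).

Record manifold4 (R : realType) := Manifold4 {
  space :> topologicalType ;
  charts : set (chart R space) ;
  space_hausdorff : hausdorff_space space ;
  space_second_countable : @second_countable space ;
  charts_cover : forall p : space, exists2 phi, charts phi & dom phi p ;
  charts_compatible : forall phi psi,
    charts phi -> charts psi -> compatible phi psi ;
  charts_maximal : forall phi,
    (forall psi, charts psi -> compatible phi psi /\ compatible psi phi) ->
    charts phi }.

(* A (1,1)-tensor field is given by its matrices in all charts (acting on
   column vectors), subject to the transformation law. *)
Definition tensor_field (R : realType) (M : manifold4 R) :=
  chart R M -> M -> 'M[R]_(2 + 2).

Definition almost_complex (R : realType) (M : manifold4 R)
    (J : tensor_field M) : Prop :=
  [/\ forall phi, charts phi ->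
        smooth_on (phi @` dom phi) (fun y => J phi (par phi y)),
      forall phi p, charts phi -> dom phi p -> J phi p *m J phi p = - 1%:M &
      forall phi psi p, charts phi -> charts psi -> dom phi p -> dom psi p ->
        forall v, 'd (transition phi psi) (phi p) (J phi p *m v) =
                  J psi p *m 'd (transition phi psi) (phi p) v].

(* In such a chart the tangent plane T_pS is { v | dsubmx v = 0 }. *)
Definition slice_chart (R : realType) (M : manifold4 R) (S : set M)
    (phi : chart R M) (p : M) : Prop :=
  [/\ charts phi, dom phi p, S p &
      forall q, dom phi q -> (S q <-> dsubmx (phi q) = dsubmx (phi p))].

Definition surface (R : realType) (M : manifold4 R) (S : set M) : Prop :=
  forall p, S p -> exists phi, slice_chart S phi p.

Definition PH_curve (R : realType) (M : manifold4 R) (J : tensor_field M)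
    (S : set M) : Prop :=
  surface S /\
  forall phi p, slice_chart S phi p ->
    forall v : 'cV[R]_(2 + 2), dsubmx v = 0 -> dsubmx (J phi p *m v) = 0.

Definition transversal (R : realType) (M : manifold4 R) (S T : set M)
    (p : M) : Prop :=
  forall phi psi, slice_chart S phi p -> slice_chart T psi p ->
    forall v : 'cV[R]_(2 + 2), dsubmx v = 0 ->
      dsubmx ('d (transition phi psi) (phi p) v) = 0 -> v = 0.

(* A foliation by surfaces is given by a foliated atlas; the foliated open set
   is the union of the chart domains.  Leaves are locally the level sets of the
   transverse coordinates dsubmx (phi q). *)
Definition support (R : realType) (M : manifold4 R) (F : set (chart R M)) :
    set M := \bigcup_(phi in F) dom phi.

Definition foliation (R : realType) (M : manifold4 R)
    (F : set (chart R M)) : Prop :=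
  F `<=` @charts R M /\
  forall phi psi p, F phi -> F psi -> dom phi p -> dom psi p ->
    exists2 V, nbhs p V &
      forall q q', V q -> V q' -> dsubmx (phi q) = dsubmx (phi q') ->
                   dsubmx (psi q) = dsubmx (psi q').

Definition plaque (R : realType) (M : manifold4 R) (phi : chart R M) (p : M) :
    set M := [set q | dom phi q /\ dsubmx (phi q) = dsubmx (phi p)].

(* Paths are parametrized by [0,1]; values elsewhere are irrelevant. *)
Definition leafwise (R : realType) (M : manifold4 R) (F : set (chart R M))
    (c : R -> M) : Prop :=
  {within `[0, 1], continuous c} /\
  forall t, 0 <= t <= 1 -> exists phi, [/\ F phi, dom phi (c t) &
    \forall s \near t, 0 <= s <= 1 -> dsubmx (phi (c s)) = dsubmx (phi (c t))].

Definition leaf (R : realType) (M : manifold4 R) (F : set (chart R M))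
    (p : M) : set M :=
  [set q | exists c, [/\ leafwise F c, c 0 = p & c 1 = q]].

(* Leaves are only immersed in general; they are unions of plaques, which are
   open in the leaf topology and embedded in M. *)
Definition PH_foliation (R : realType) (M : manifold4 R) (J : tensor_field M)
    (F : set (chart R M)) : Prop :=
  foliation F /\
  forall phi p, F phi -> dom phi p -> PH_curve J (plaque phi p).

(* Homeomorphic to R^2, i.e. to an open disk. *)
Definition disk (R : realType) (M : manifold4 R) (D : set M) : Prop :=
  exists (h : 'cV[R]_2 -> M) (k : M -> 'cV[R]_2),
    [/\ continuous h, h @` setT = D, cancel h k &
        {within D, continuous k}].

(* The family z |-> D_z = leaf G z, for z in L. *)
Definition transversal_PH_disks (R : realType) (M : manifold4 R)
    (J : tensor_field M) (L : set M) (G : set (chart R M)) : Prop :=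
  [/\ PH_foliation J G,
      L `<=` support G,
      support G = \bigcup_(z in L) leaf G z &
      forall z, L z ->
        [/\ PH_curve J (leaf G z), disk (leaf G z),
            leaf G z `&` L = [set z] & transversal L (leaf G z) z]].

(* f represents the germ at c 0 of the map D1 -> D2 obtained by shifting points
   of D1 along the leaves of H following the path c. *)
Definition transport (R : realType) (M : manifold4 R) (H : set (chart R M))
    (D1 D2 : set M) (c : R -> M) (f : M -> M) : Prop :=
  exists2 V, nbhs (c 0) V &
  exists K : M -> R -> M,
    [/\ {within (D1 `&` V) `*` (`[0, 1] : set R),
           continuous (fun wt : M * R => K wt.1 wt.2)},
        forall t, 0 <= t <= 1 -> K (c 0) t = c t &
        forall w, D1 w -> V w ->
          [/\ leafwise H (K w), K w 0 = w, K w 1 = f w & D2 (f w)]].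

(* When D is a PH curve and phi a slice chart of D at q, ulsubmx (J phi q) is
   the matrix of J restricted to T_qD. *)
Definition PH_germ (R : realType) (M : manifold4 R) (J : tensor_field M)
    (D1 D2 : set M) (z : M) (f : M -> M) : Prop :=
  \forall q \near z, D1 q ->
    [/\ D2 (f q), f x @[x --> within D1 (nbhs q)] --> f q &
        forall phi psi, slice_chart D1 phi q -> slice_chart D2 psi (f q) ->
          let g := fun s : 'cV[R]_2 =>
            usubmx (psi (f (par phi (col_mx s (dsubmx (phi q)))))) in
          let s0 := usubmx (phi q) in
          differentiable g s0 /\
          forall v, 'd g s0 (ulsubmx (J phi q) *m v) =
                    ulsubmx (J psi (f q)) *m 'd g s0 v].

Definition PH_transports (R : realType) (M : manifold4 R) (J : tensor_field M)
    (L : set M) (G H : set (chart R M)) : Prop :=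
  forall (c : R -> M) (f : M -> M),
    {within `[0, 1], continuous c} -> (forall t, 0 <= t <= 1 -> L (c t)) ->
    transport H (leaf G (c 0)) (leaf G (c 1)) c f ->
    PH_germ J (leaf G (c 0)) (leaf G (c 1)) (c 0) f.

(* Having pseudoholomorphic transports does not depend on the transversal
   family G, so it is enough to ask for one such family. *)
Definition has_PH_foliation_with_PH_transports (R : realType)
    (M : manifold4 R) (L : set M) (J : tensor_field M) : Prop :=
  exists H, [/\ PH_foliation J H, L `<=` support H,
    forall x, L x -> leaf H x = L &
    exists G, transversal_PH_disks J L G /\ PH_transports J L G H].

Definition pderiv (R : realType) (E : normedModType R) (n : nat) (i : 'I_n)
    (f : 'cV[R]_n -> E) : 'cV[R]_n -> E :=
  fun y => 'D_(delta_mx i 0) f y.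

Definition mderiv (R : realType) (E : normedModType R) (n : nat)
    (a : 'I_n -> nat) (f : 'cV[R]_n -> E) : 'cV[R]_n -> E :=
  foldr (fun i g => iter (a i) (pderiv i) g) f (enum 'I_n).

Definition multi_index (m : nat) :=
  {a : {ffun 'I_(2 + 2) -> 'I_m.+1} | (\sum_i a i <= m)%N}.

(* Partial derivatives of order <= m of the 16 entries: one row for each
   multi-index. *)
Notation jet_space R m := 'M[R]_(#|{: multi_index m}|, (2 + 2) * (2 + 2)).

Definition jet (R : realType) (m : nat) (A : 'cV[R]_(2 + 2) -> 'M[R]_(2 + 2))
    (y : 'cV[R]_(2 + 2)) : jet_space R m :=
  \matrix_(r < #|{: multi_index m}|)
    mxvec (mderiv (fun i => val (enum_val r) i : nat) A y).

(* m-jets at x, read in a chart phi straightening L, of the almost complex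
   structures defined near x for which L is pseudoholomorphic. *)
Definition structure_jets (R : realType) (M : manifold4 R) (L : set M)
    (phi : chart R M) (x : M) (m : nat) : set (jet_space R m) :=
  [set j | exists (A : 'cV[R]_(2 + 2) -> 'M[R]_(2 + 2))
                  (V : set 'cV[R]_(2 + 2)),
    [/\ [/\ open V, V (phi x) & V `<=` phi @` dom phi], smooth_on V A,
        forall y, V y -> A y *m A y = - 1%:M,
        forall y, V y -> L (par phi y) ->
          forall v : 'cV[R]_(2 + 2), dsubmx v = 0 -> dsubmx (A y *m v) = 0 &
        j = jet m A (phi x)]].

Arguments structure_jets {R M} L phi x m.

Definition tangent_vectors (R : realType) (E : normedModType R) (X : set E)
    (p : E) : set E :=
  [set w | exists c : R -> E,
    [/\ c 0 = p, \forall t \near (0 : R), X (c t) &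
        is_derive (0 : R) (1 : R) c w]].

(* Submanifolds of codimension d of a submanifold X of E: locally the zero set
   in X of a smooth R^d-valued map which is a submersion on X. *)
Definition codim_submanifold (R : realType) (E : normedModType R)
    (X S : set E) (d : nat) : Prop :=
  S `<=` X /\
  forall p, S p -> exists (U : set E) (f : E -> 'cV[R]_d),
    [/\ open U, U p, smooth_on U f,
        forall q, U q -> (S q <-> X q /\ f q = 0) &
        forall v, exists2 w, tangent_vectors X p w & 'd f p w = v].

Definition codim_ge (R : realType) (E : normedModType R) (X S : set E)
    (c : nat) : Prop :=
  exists (n : nat) (T : 'I_n -> set E) (d : 'I_n -> nat),
    (forall i, (c <= d i)%N /\ codim_submanifold X (T i) (d i)) /\
    S `<=` \bigcup_i T i.

Definition codim_infinity (R : realType) (M : manifold4 R) (L : set M)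
    (P : tensor_field M -> Prop) : Prop :=
  forall x phi, slice_chart L phi x ->
  exists S : forall m, set (jet_space R m),
    (forall m (J : tensor_field M),
       almost_complex J -> PH_curve J L -> P J ->
       S m (jet m (fun y => J phi (par phi y)) (phi x))) /\
    (forall c, \forall m \near \oo, codim_ge (structure_jets L phi x m) (S m) c).

(* Main.v *)
Require Import Defs.
From HB Require Import structures.
From mathcomp Require Import all_boot all_order all_algebra.
From mathcomp Require Import all_classical all_reals all_analysis.
From mathcomp Require Import ring lra.

Set Implicit Arguments.
Unset Strict Implicit.
Unset Printing Implicit Defensive.

Import Order.TTheory GRing.Theory Num.Theory numFieldNormedType.Exports.

Local Open Scope classical_set_scope.
Local Open Scope ring_scope.

(* Near a point of L the leaves of H and of the transversal disks give product
   coordinates, in which transport along L keeps the coordinate w that is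
   constant on the leaves of H.  If the leaves of H are pseudoholomorphic, then
   dw o J = e o dw for a matrix e, and if the transports are pseudoholomorphic
   as well, then e is constant along L.  Differentiating along and across L
   shows that the component of the Nijenhuis tensor transverse to L vanishes at
   the points of L.  Its first m derivatives in one direction of L at x are
   quadratic functions of the m-jet of J.  They are independent: conjugating J
   by 1 + s b E, where E is a constant matrix of square zero and b a function
   vanishing on L, leaves J unchanged on L and changes a scalar component of
   that tensor along L by s times an arbitrary function. *)

(** * Functions of class C^k *)

Section Smooth.
Context {R : realType}.
Implicit Types E F G : normedModType R.

(** Codimension is measured inside the set of jets of structures. That set is not given as a
    manifold: its tangent vectors are velocities of curves of jets. Independence of the equations
    therefore has to be shown by explicit curves of almost complex structures that keep L
    pseudoholomorphic. Conjugation preserves the equation for the square of J, and since E has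
    square zero the conjugate is quadratic in s, so the velocity of its jet is read off directly.
    The deformation acts on the tensor through a product of two off-diagonal entries of J; on L
    neither can vanish, as no real number has square -1, so the product can be divided out. One
    scalar entry and one direction suffice, since they already give m equations on m-jets: the
    derivatives have order 0 to m - 1, the tensor itself containing first derivatives of J. In the
    other direction, the hypothesis speaks only of transports that exist. One has to be constructed
    along each short segment of L, and the inverse function theorem supplies the product coordinates
    for it. The second derivatives of w, which are not controlled, cancel by symmetry. *)

Lemma is_diff_near E F (f g df : E -> F) (x : E) :
  {near x, f =1 g} -> is_diff x f df -> is_diff x g df.
Proof.
move=> fg [dfx dfE].
have fgx : f x = g x := nbhs_singleton fg.
have gE : g \o shift x = cst (g x) + 'd f x +o_ 0 id.
  apply/eqaddoP => e e0.
  have /eqaddoP/(_ e e0) := diff_locally dfx.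
  have : \forall y \near 0, f (y + x) = g (y + x).
    have := near_shift 0 x (fun y => f y = g y); rewrite subr0 => <-.
    exact: fg.
  by apply: filterS2 => y fgy; rewrite !fctE /= fgx fgy.
have dgE := diff_unique (diff_continuous dfx) gE.
apply: DiffDef; last by rewrite dgE.
by apply/diff_locallyP; rewrite dgE; split => //; exact: diff_continuous.
Qed.

Lemma near_open_eq E F (U : set E) (f g : E -> F) (x : E) :
  open U -> U x -> (forall y, U y -> f y = g y) -> {near x, f =1 g}.
Proof.
by move=> oU Ux fg; apply: filterS (open_nbhs_nbhs (conj oU Ux)) => y /fg.
Qed.

Lemma Ck_eq E F k (U : set E) (f g : E -> F) : open U ->
  (forall x, U x -> f x = g x) -> Ck k U f -> Ck k U g.
Proof.
move=> oU; elim: k f g => [|k IH] f g fg /=.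
  move=> cf x Ux; have fx := near_open_eq oU Ux fg.
  change (g @ x --> g x); rewrite -(fg x Ux).
  exact: (cvg_trans (near_eq_cvg fx) (cf x Ux)).
move=> [df Cf]; split => [x Ux|v].
  have [] := is_diff_near (near_open_eq oU Ux fg) (differentiableP (df x Ux)).
  by [].
apply: IH (Cf v) => x Ux.
have [_ ->] := is_diff_near (near_open_eq oU Ux fg) (differentiableP (df x Ux)).
by [].
Qed.

Lemma Ck_sub E F k (U V : set E) (f : E -> F) : V `<=` U ->
  Ck k U f -> Ck k V f.
Proof.
move=> VU; elim: k f => [|k IH] f /=; first by move=> cf x /VU/cf.
by move=> [df Cf]; split=> [x /VU/df|v]//; exact: IH.
Qed.

Lemma CkW E F k (U : set E) (f : E -> F) : Ck k.+1 U f -> Ck k U f.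
Proof.
elim: k f => [|k IH] f /= [df Cf].
  by move=> x Ux; apply: differentiable_continuous; exact: df.
by split => // v; exact/IH/Cf.
Qed.

(** [Ck] speaks of the canonical differential. Any formula for it that is valid on the open set U
    may replace it, so the inductions on k can follow the usual rules of calculus. *)
Lemma CkS_intro E F k (U : set E) (f : E -> F) (df : E -> E -> F) : open U ->
  (forall x, U x -> is_diff x f (df x)) -> (forall v, Ck k U (df ^~ v)) ->
  Ck k.+1 U f.
Proof.
move=> oU dfE Cdf; split=> [x Ux|v]; first by have [] := dfE x Ux.
by apply: Ck_eq (Cdf v) => // x Ux; have [_ ->] := dfE x Ux.
Qed.

Lemma Ck_cst E F k (U : set E) (a : F) : open U -> Ck k U (cst a : E -> F).
Proof.
move=> oU; elim: k a => [|k IH] a; first by move=> x _; exact: cst_continuous.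
apply: (CkS_intro (df := fun _ => cst 0)) => // v; exact: IH.
Qed.

Lemma CkD E F k (U : set E) (f g : E -> F) : open U ->
  Ck k U f -> Ck k U g -> Ck k U (f + g).
Proof.
move=> oU; elim: k f g => [|k IH] f g.
  by move=> cf cg x Ux; apply: continuousD; [exact: cf|exact: cg].
move=> [df Cf] [dg Cg].
pose dfg x : E -> F := ('d f x : E -> F) + ('d g x : E -> F).
have is_d x : U x -> is_diff x (f + g) (dfg x).
  by move=> Ux; exact: is_diffD (differentiableP (df x Ux)) (differentiableP (dg x Ux)).
by apply: (CkS_intro oU is_d) => v; exact: IH (Cf v) (Cg v).
Qed.

Lemma Ck_sum E F k (U : set E) (I : Type) (r : seq I) (P : pred I)
    (f : I -> E -> F) : open U ->
  (forall i, Ck k U (f i)) -> Ck k U (\sum_(i <- r | P i) f i).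
Proof.
move=> oU Cf; elim/big_ind: _ => //; first exact: Ck_cst.
by move=> *; exact: CkD.
Qed.

Lemma Ck_lin E F G k (U : set E) (f : E -> F) (l : {linear F -> G}) : open U ->
  continuous l -> Ck k U f -> Ck k U (l \o f).
Proof.
move=> oU cl; elim: k f => [|k IH] f.
  by move=> cf x Ux; apply: continuous_comp; [exact: cf|exact: cl].
move=> [df Cf]; apply: (CkS_intro (df := fun x => l \o 'd f x)) => //.
- move=> x Ux; apply: is_diff_comp; first exact/differentiableP/df.
  by apply: DiffDef; [exact: linear_differentiable|exact: diff_lin].
- by move=> v; apply: IH; exact: Cf.
Qed.

Lemma CkM E k (U : set E) (f g : E -> R) : open U ->
  Ck k U f -> Ck k U g -> Ck k U (f * g).
Proof.
move=> oU; elim: k f g => [|k IH] f g.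
  by move=> cf cg x Ux; apply: continuousM; [exact: cf|exact: cg].
move=> Cf Cg.
have [df Cdf] := Cf; have [dg Cdg] := Cg.
pose dfg x : E -> R := f x *: ('d g x : E -> R) + g x *: ('d f x : E -> R).
have is_d x : U x -> is_diff x (f * g) (dfg x).
  by move=> Ux; exact: is_diffM (differentiableP (df x Ux)) (differentiableP (dg x Ux)).
apply: (CkS_intro oU is_d).
move=> v; apply: (CkD (f := f * (fun x => 'd g x v)) (g := g * (fun x => 'd f x v))) => //.
  by apply: IH; [exact: CkW|exact: Cdg].
by apply: IH; [exact: CkW|exact: Cdf].
Qed.

Lemma Ck_id E k (U : set E) : open U -> Ck k U (id : E -> E).
Proof.
move=> oU; case: k => [|k]; first by move=> x _; exact: cvg_id.
apply: (CkS_intro (df := fun=> id)) => // v; exact: Ck_cst.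
Qed.

(** The derivative of [1/f] contains [1/f] again, but only to the class already reached by the
    induction. *)
Lemma CkV E k (U : set E) (f : E -> R) : open U ->
  (forall x, U x -> f x != 0) ->
  Ck k U f -> Ck k U (fun x => (f x)^-1).
Proof.
move=> oU f0; elim: k => [|k IH].
  by move=> cf x Ux; apply: continuousV; [exact: f0|exact: cf].
move=> Cf; have [df Cdf] := Cf.
have Cif := IH (CkW Cf).
pose dif x : E -> R := - (f x) ^- 2 *: ('d f x : E -> R).
have is_d x : U x -> is_diff x (fun x => (f x)^-1) (dif x).
  move=> Ux; apply: DiffDef; first by apply: differentiableV; [exact: df|exact: f0].
  by rewrite diffV ?f0//; exact: df.
apply: (CkS_intro oU is_d) => v.
pose finv x := (f x)^-1.
apply: (Ck_eq (f := cst (-1) * (finv * finv) * (fun x => 'd f x v)) oU); last first.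
  exact: CkM oU (CkM oU (Ck_cst _ _ oU) (CkM oU Cif Cif)) (Cdf v).
move=> x _; change (-1 * ((f x)^-1 * (f x)^-1) * 'd f x v = - (f x) ^- 2 * 'd f x v).
by rewrite mulN1r -invfM -expr2.
Qed.

End Smooth.

(** * Iterated directional derivatives *)

Section MatrixValued.
Context {R : realType}.
Implicit Types E F G : normedModType R.

(** Named so that taking an entry can carry the structure of a linear map. *)
Definition entry m n (i : 'I_m) (j : 'I_n) (A : 'M[R]_(m, n)) : R := A i j.

Lemma entry_is_linear m n (i : 'I_m) (j : 'I_n) : linear (@entry m n i j).
Proof. by move=> a A B; rewrite /entry !mxE. Qed.

HB.instance Definition _ m n (i : 'I_m) (j : 'I_n) :=
  GRing.isLinear.Build R 'M[R]_(m, n) R *%R (@entry m n i j) (entry_is_linear i j).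

Lemma cvg_sumr (T : Type) (F : set_system T) {FF : Filter F} E (I : Type)
    (r : seq I) (f : I -> T -> E) (a : I -> E) :
  (forall i, f i @ F --> a i) ->
  \sum_(i <- r) f i x @[x --> F] --> \sum_(i <- r) a i.
Proof.
move=> fa; elim: r => [|i r IH].
  by rewrite big_nil; under eq_fun do rewrite big_nil; exact: cvg_cst.
by rewrite big_cons; under eq_fun do rewrite big_cons; exact: cvgD.
Qed.

Lemma mx_linear_continuous m n F (l : {linear 'M[R]_(m, n) -> F}) :
  continuous l.
Proof.
have -> : l = (fun A => \sum_i \sum_j A i j *: l (delta_mx i j)) :> (_ -> _).
  apply/funext => A; rewrite {1}(matrix_sum_delta A) linear_sum.
  apply: eq_bigr => i _; rewrite linear_sum; apply: eq_bigr => j _.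
  by rewrite linearZ.
move=> A; apply: (@cvg_sumr _ (nbhs A)) => i; apply: (@cvg_sumr _ (nbhs A)) => j.
by apply: cvgZr_tmp; exact: coord_continuous.
Qed.

Lemma Ck_mxlin E F k (U : set E) m n (f : E -> 'M[R]_(m, n))
    (l : {linear 'M[R]_(m, n) -> F}) : open U ->
  Ck k U f -> Ck k U (fun x => l (f x)).
Proof. by move=> oU; apply: Ck_lin => //; exact: mx_linear_continuous. Qed.

Lemma Ck_entry E k (U : set E) m n (f : E -> 'M[R]_(m, n)) i j : open U ->
  Ck k U f -> Ck k U (fun x => f x i j).
Proof. by move=> oU Cf; exact: (Ck_mxlin (entry i j) oU Cf). Qed.

Lemma Ck_mx E k (U : set E) m n (f : E -> 'M[R]_(m, n)) : open U ->
  (forall i j, Ck k U (fun x => f x i j)) -> Ck k U f.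
Proof.
move=> oU Cf.
apply: (Ck_eq (f := \sum_i \sum_j (fun x => f x i j *: delta_mx i j))) => //.
  move=> x _; rewrite [RHS]matrix_sum_delta fct_sumE; apply: eq_bigr => i _.
  by rewrite fct_sumE.
apply: Ck_sum => // i; apply: Ck_sum => // j.
have sxlin : linear ( *:%R ^~ (delta_mx i j : 'M[R]_(m, n)) : R -> _).
  by move=> a b c; rewrite scalerDl scalerA.
pose sxM := GRing.isLinear.Build _ _ _ _ _ sxlin.
pose sxL : {linear R -> 'M[R]_(m, n)} := HB.pack ( *:%R ^~ (delta_mx i j)) sxM.
have csx : continuous sxL by exact: scalel_continuous.
exact: (Ck_lin oU csx (Cf i j)).
Qed.

Lemma diff_mxlin E F m n (f : E -> 'M[R]_(m, n)) (l : {linear 'M[R]_(m, n) -> F}) x :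
  differentiable f x -> is_diff x (fun y => l (f y)) (fun v => l ('d f x v)).
Proof.
move=> df; have cl := @mx_linear_continuous _ _ _ l.
apply: (is_diff_comp (g := l) (dg := l)); first exact: differentiableP.
by apply: DiffDef; [exact: linear_differentiable|exact: diff_lin].
Qed.

Lemma diff_entry E m n (f : E -> 'M[R]_(m, n)) x i j :
  differentiable f x -> is_diff x (fun y => f y i j) (fun v => 'd f x v i j).
Proof. exact: (diff_mxlin (entry i j)). Qed.

End MatrixValued.

Section DirectionalDerivatives.
Context {R : realType}.
Implicit Types E F G : normedModType R.

Lemma smooth_differentiable E F (U : set E) (f : E -> F) x :
  smooth_on U f -> U x -> differentiable f x.
Proof. by move=> /(_ 1%N)[+ _] Ux; exact. Qed.

Lemma smooth_derivable E F (U : set E) (f : E -> F) x v :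
  smooth_on U f -> U x -> derivable f x v.
Proof. by move=> sf Ux; apply: diff_derivable; exact: smooth_differentiable sf Ux. Qed.

Lemma smooth_derive E F (U : set E) (f : E -> F) v : open U ->
  smooth_on U f -> smooth_on U ('D_v f).
Proof.
move=> oU sf k; have [df /(_ v)] := sf k.+1.
by apply: Ck_eq => // x Ux; rewrite deriveE//; exact: df.
Qed.

Lemma smooth_iter_derive E F (U : set E) (f : E -> F) v l : open U ->
  smooth_on U f -> smooth_on U (iter l (fun g => 'D_v g) f).
Proof. by move=> oU sf; elim: l => //= l IH; exact: smooth_derive. Qed.

Lemma derive_eq_on E F (U : set E) (f g : E -> F) v : open U ->
  (forall x, U x -> f x = g x) -> forall x, U x -> 'D_v f x = 'D_v g x.
Proof.
by move=> oU fg x Ux; apply: near_eq_derive; exact: near_open_eq oU Ux fg.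
Qed.

Lemma derive_entry E (U : set E) m n (f : E -> 'M[R]_(m, n)) v x i j :
  smooth_on U f -> U x -> 'D_v f x i j = 'D_v (fun y => f y i j) x.
Proof.
move=> sf Ux; have df := smooth_differentiable sf Ux.
have [de deE] := diff_entry i j df.
by rewrite !deriveE// deE.
Qed.

Lemma iter_derive_entry E (U : set E) m n (f : E -> 'M[R]_(m, n)) v l i j :
  open U -> smooth_on U f -> forall x, U x ->
  iter l (fun g => 'D_v g) f x i j = iter l (fun g => 'D_v g) (fun y => f y i j) x.
Proof.
move=> oU sf; elim: l => [//|l IH] x Ux /=.
rewrite (derive_entry _ _ _ (smooth_iter_derive v l oU sf) Ux).
exact: derive_eq_on Ux.
Qed.

Lemma derive_line E F (f : E -> F) v y0 (r : R) :
  'D_v f (y0 + r *: v) = 'D_1 (fun s : R => f (y0 + s *: v)) r.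
Proof.
suff E1 : (fun h : R => h^-1 *: ((f \o shift (y0 + r *: v)) (h *: v) - f (y0 + r *: v))) =
  (fun h : R => h^-1 *: (((fun s : R => f (y0 + s *: v)) \o shift r) (h *: 1) -
    f (y0 + r *: v))) by rewrite /derive E1.
apply/funext => h /=; congr (_ *: (f _ - _)).
by rewrite [h *: 1]mulr1 scalerDl addrCA.
Qed.

(** Iterated derivatives in the direction v see only the restriction to the line. Identities known
    only on L can thus be differentiated along L, although L has empty interior. *)
Lemma iter_derive_line E F (f g : E -> F) v y0 l :
  (\forall r \near (0 : R), f (y0 + r *: v) = g (y0 + r *: v)) ->
  \forall r \near (0 : R), iter l (fun g => 'D_v g) f (y0 + r *: v) =
                           iter l (fun g => 'D_v g) g (y0 + r *: v).
Proof.
move=> fg; elim: l => [//|l IH] /=.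
have {IH} : \forall r \near (0 : R), \forall s \near r,
  iter l (fun g => 'D_v g) f (y0 + s *: v) =
  iter l (fun g => 'D_v g) g (y0 + s *: v).
  exact: nbhs_interior.
apply: filterS => r fgr; rewrite !derive_line.
exact: near_eq_derive.
Qed.

Lemma smoothZ E F (U : set E) (a : R) (f : E -> F) : open U ->
  smooth_on U f -> smooth_on U (fun x => a *: f x).
Proof.
move=> oU sf k; have ca : continuous ( *:%R a : {linear F -> F}).
  exact: scaler_continuous.
exact: Ck_lin oU ca (sf k).
Qed.

Lemma smoothD E F (U : set E) (f g : E -> F) : open U ->
  smooth_on U f -> smooth_on U g -> smooth_on U (fun x => f x + g x).
Proof. by move=> oU sf sg k; exact: CkD. Qed.

Lemma iter_deriveD E F (U : set E) (f g : E -> F) v l : open U ->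
  smooth_on U f -> smooth_on U g -> forall x, U x ->
  iter l (fun h => 'D_v h) (fun y => f y + g y) x =
  iter l (fun h => 'D_v h) f x + iter l (fun h => 'D_v h) g x.
Proof.
move=> oU sf sg; elim: l => [//|l IH] x Ux /=.
rewrite (derive_eq_on v oU IH Ux).
have df := smooth_derivable (v := v) (smooth_iter_derive v l oU sf) Ux.
have dg := smooth_derivable (v := v) (smooth_iter_derive v l oU sg) Ux.
exact: (deriveD df dg).
Qed.

Lemma iter_deriveZ E F (U : set E) (f : E -> F) (a : R) v l : open U ->
  smooth_on U f -> forall x, U x ->
  iter l (fun h => 'D_v h) (fun y => a *: f y) x =
  a *: iter l (fun h => 'D_v h) f x.
Proof.
move=> oU sf; elim: l => [//|l IH] x Ux /=.
rewrite (derive_eq_on v oU IH Ux).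
exact: (deriveZ a (smooth_derivable (v := v) (smooth_iter_derive v l oU sf) Ux)).
Qed.

Lemma smoothM E (U : set E) (f g : E -> R) : open U ->
  smooth_on U f -> smooth_on U g -> smooth_on U (fun x => f x * g x).
Proof. by move=> oU sf sg k; exact: CkM. Qed.

Lemma smooth_sum E F (U : set E) (I : Type) (r : seq I) (P : pred I)
    (f : I -> E -> F) : open U -> (forall i, smooth_on U (f i)) ->
  smooth_on U (fun x => \sum_(i <- r | P i) f i x).
Proof.
move=> oU sf k.
have -> : (fun x => \sum_(i <- r | P i) f i x) = \sum_(i <- r | P i) f i.
  by apply/funext => x; rewrite fct_sumE.
by apply: Ck_sum => // i; exact: sf.
Qed.

Lemma iter_derive_sum E (U : set E) (I : Type) (r : seq I) (f : I -> E -> R) v l :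
  open U -> (forall i, smooth_on U (f i)) -> forall x, U x ->
  iter l (fun h => 'D_v h) (fun y => \sum_(i <- r) f i y) x =
  \sum_(i <- r) iter l (fun h => 'D_v h) (f i) x.
Proof.
move=> oU sf x Ux; elim: r => [|i r IH].
  rewrite big_nil.
  have -> : (fun y => \sum_(i <- [::]) f i y) = cst 0 :> (E -> R).
    by apply/funext => y; rewrite big_nil.
  elim: l => //= l IH; rewrite (_ : iter l _ _ = cst 0) ?derive_cst//.
  elim: {IH}l => //= l ->; apply/funext => y; exact: derive_cst.
rewrite big_cons -IH -(iter_deriveD v l oU (sf i) _ Ux)//.
  by congr (iter _ _ _ _); apply/funext => y; rewrite big_cons.
exact: smooth_sum.
Qed.

Lemma iter_deriveM E (U : set E) (f g : E -> R) v l : open U ->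
  smooth_on U f -> smooth_on U g -> forall x, U x ->
  iter l (fun h => 'D_v h) (fun y => f y * g y) x =
  \sum_(i < l.+1) 'C(l, i)%:R *
    (iter i (fun h => 'D_v h) f x * iter (l - i) (fun h => 'D_v h) g x).
Proof.
move=> oU sf sg; pose D i h := iter i (fun h : E -> R => 'D_v h) h.
have sD i h : smooth_on U h -> smooth_on U (D i h).
  by move=> sh; exact: smooth_iter_derive.
elim: l => [|l IH] x Ux; first by rewrite big_ord1 bin0 mul1r.
rewrite [LHS]/= (derive_eq_on v oU IH Ux).
rewrite -[LHS]/(iter 1 (fun h => 'D_v h) _ x).
have sfg i j : smooth_on U (fun y => D i f y * D j g y) by apply: smoothM; auto.
rewrite (iter_derive_sum (f := fun (i : 'I_l.+1) y =>
  'C(l, i)%:R * (D i f y * D (l - i)%N g y)) _ _ _ oU _ Ux); last first.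
  by move=> i; exact: smoothZ.
under eq_bigr => i _.
  rewrite (iter_deriveZ ('C(l, i)%:R : R) v 1 oU (sfg _ _) Ux) [iter 1 _ _ _]/=.
  rewrite (deriveM (smooth_derivable (v := v) (sD i _ sf) Ux)
                   (smooth_derivable (v := v) (sD (l - i)%N _ sg) Ux)).
  rewrite -[X in _ *: X + _]/(D (l - i).+1 g x) -[X in _ + _ *: X]/(D i.+1 f x).
  rewrite /GRing.scale /= mulrDr (mulrC (D _ g _)).
  over.
(* The extreme terms are split off; the inner ones combine by Pascal's rule. *)
rewrite big_split /= big_ord_recl [in RHS]big_ord_recl /= !bin0 subn0 -!addrA.
congr (_ + _).
rewrite [in RHS]big_ord_recr big_ord_recr /= /bump /= !add1n !binn !subnn addrA.
congr (_ + _).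
rewrite -big_split /=; apply: eq_bigr => i _.
rewrite !add1n !add0n binS natrD mulrDl subSS; congr (_ * (_ * _) + _).
by rewrite -[LHS]/(D (l - i.+1).+1 g x) subnSK.
Qed.

End DirectionalDerivatives.

(** * Symmetry of second derivatives and the inverse function theorem *)

(** The fixed point theorem used in [inverse_function] asks for a complete normed space. *)
HB.instance Definition _ (R : realType) m n :=
  Complete.copy 'M[R]_(m, n) 'M[R]_(m, n).

Section InverseFunction.
Context {R : realType}.
Implicit Types E F G : normedModType R.

Lemma open_normP E (U : set E) x : open U -> U x ->
  exists2 r : R, 0 < r & forall y, `|y - x| < r -> U y.
Proof.
move=> oU Ux; have /nbhs_ballP[r r0 rU] := open_nbhs_nbhs (conj oU Ux).
by exists r => // y yx; apply: rU; rewrite -ball_normE /= distrC.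
Qed.

Lemma is_derive_line E F (f : E -> F) y v (r : R) :
  differentiable f (y + r *: v) ->
  is_derive r (1 : R) (fun s : R => f (y + s *: v)) ('d f (y + r *: v) v).
Proof.
move=> df; pose line := fun s : R => y + s *: v.
have dl : is_diff r line ( *:%R ^~ v).
  have := is_diffD (is_diff_cst y r) (is_diff_scalel r v).
  by rewrite add0r.
have [dc dcE] := @is_diff_comp _ _ _ _ line _ f _ r dl (differentiableP df).
apply: DeriveDef; first exact: diff_derivable.
by rewrite deriveE//= dcE /= scale1r.
Qed.

Lemma continuous_line (E : normedModType R) (y w : E) :
  continuous (fun s : R => y + s *: w).
Proof.
move=> s; have [d _] := is_diffD (is_diff_cst y s) (is_diff_scalel s w).
exact: differentiable_continuous d.
Qed.

Lemma MVT_line E (f : E -> R) y v :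
  (forall r : R, 0 <= r <= 1 -> differentiable f (y + r *: v)) ->
  exists2 r : R, 0 <= r <= 1 & f (y + v) - f y = 'd f (y + r *: v) v.
Proof.
move=> df.
have dg (r : R) : 0 <= r <= 1 -> is_derive r (1 : R) (fun s : R => f (y + s *: v)) ('d f (y + r *: v) v).
  by move=> r01; apply: is_derive_line; exact: df.
have cg : {within `[0, 1], continuous (fun s : R => f (y + s *: v))}.
  apply: derivable_within_continuous => r; rewrite in_itv /= => r01.
  by have [] := dg _ r01.
have dg' (r : R) : r \in `]0, 1[%R -> is_derive r (1 : R) (fun s : R => f (y + s *: v)) ('d f (y + r *: v) v).
  by rewrite in_itv /= => /andP[r0 r1]; apply: dg; rewrite !ltW.
have [r] := MVT ltr01 dg' cg.
rewrite in_itv /= => /andP[r0 r1]; rewrite scale1r scale0r addr0 subr0 mulr1 => ->.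
by exists r => //; rewrite !ltW.
Qed.

(** The mean value theorem is applied twice: to the increment of f by [h *: v], along u, and then to
    the derivative of f in the direction u, along v. *)
Lemma Ck2_second_difference E (U : set E) (f : E -> R) x u v (r h : R) :
  Ck 2 U f -> (forall y, `|y - x| < r -> U y) ->
  0 < h -> h * (`|u| + `|v|) < r ->
  exists2 y, `|y - x| < r &
    f (x + h *: u + h *: v) - f (x + h *: u) - (f (x + h *: v) - f x) =
    h * h * 'd (fun z => 'd f z u) y v.
Proof.
move=> [df Cdf] rU h0 hr.
have near_x (s t : R) : 0 <= s <= 1 -> 0 <= t <= 1 ->
    `|x + s *: (h *: u) + t *: (h *: v) - x| < r.
  move=> /andP[s0 s1] /andP[t0 t1].
  apply: le_lt_trans hr; rewrite -[x + _ + _]addrA addrAC subrr add0r.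
  rewrite (le_trans (ler_normD _ _))// !normrZ mulrDr (gtr0_norm h0).
  by apply: lerD; rewrite ler_piMl ?mulr_ge0 ?(ltW h0)// ger0_norm.
have zero01 : 0 <= (0 : R) <= 1 by rewrite lexx ler01.
have one01 : 0 <= (1 : R) <= 1 by rewrite lexx ler01.
have dfx (s t : R) : 0 <= s <= 1 -> 0 <= t <= 1 ->
    differentiable f (x + s *: (h *: u) + t *: (h *: v)).
  by move=> s01 t01; apply: df; apply: rU; exact: near_x.
pose g y := f (y + h *: v) - f y.
have dg (s : R) : 0 <= s <= 1 -> is_diff (x + s *: (h *: u)) g
    (('d f (x + s *: (h *: u) + h *: v) : E -> R) - ('d f (x + s *: (h *: u)) : E -> R)).
  move=> s01; apply: is_diffB; last first.
    by have := dfx s 0 s01 zero01; rewrite scale0r addr0; exact: differentiableP.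
  have dsh : is_diff (x + s *: (h *: u)) (fun y => y + h *: v) id.
    have := is_diffD (is_diff_id (x + s *: (h *: u))) (is_diff_cst (h *: v) (x + s *: (h *: u))).
    by rewrite addr0.
  have := dfx s 1 s01 one01; rewrite scale1r => /differentiableP dff.
  exact: (is_diff_comp dsh dff).
have [s s01] : exists2 s : R, 0 <= s <= 1 &
    g (x + h *: u) - g x = 'd g (x + s *: (h *: u)) (h *: u).
  by apply: MVT_line => s s01; have [] := dg s s01.
have [_ ->] := dg s s01.
have [d2f _] := Cdf u.
have [t t01] : exists2 t : R, 0 <= t <= 1 &
  'd f (x + s *: (h *: u) + h *: v) u - 'd f (x + s *: (h *: u)) u =
  'd (fun z => 'd f z u) (x + s *: (h *: u) + t *: (h *: v)) (h *: v).
  by apply: MVT_line => t t01; apply: d2f; apply: rU; exact: near_x.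
move=> E2 E1; exists (x + s *: (h *: u) + t *: (h *: v)); first exact: near_x.
rewrite -[LHS]/(g (x + h *: u) - g x) E1 -mulrA -[X in _ = h * X]linearZ -E2.
have L z : 'd f z (h *: u) = h * 'd f z u by exact: linearZ.
by rewrite !fctE /= !L mulrBr.
Qed.

(** The second difference is symmetric in u and v, so the two mixed derivatives agree at two points
    arbitrarily near x; continuity does the rest. *)
Lemma schwarz E (U : set E) (f : E -> R) x u v : open U -> Ck 2 U f -> U x ->
  'd (fun z => 'd f z u) x v = 'd (fun z => 'd f z v) x u.
Proof.
move=> oU Cf Ux; have [df Cdf] := Cf.
pose a z := 'd (fun z => 'd f z u) z v; pose b z := 'd (fun z => 'd f z v) z u.
have ca : {for x, continuous a} by have [_ /(_ v)] := Cdf u; exact.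
have cb : {for x, continuous b} by have [_ /(_ u)] := Cdf v; exact.
suff : `|a x - b x| <= 0 by rewrite normr_le0 subr_eq0 => /eqP.
apply/ler_addgt0Pr => e e0; rewrite add0r.
have e2 : 0 < e / 2 by rewrite divr_gt0.
have [r r0 rP] : exists2 r : R, 0 < r & forall y, `|y - x| < r ->
    [/\ U y, `|a x - a y| < e / 2 & `|b x - b y| < e / 2].
  have : \forall y \near x, [/\ U y, `|a x - a y| < e / 2 & `|b x - b y| < e / 2].
    near=> y; split.
    - by near: y; exact: open_nbhs_nbhs.
    - by near: y; move/cvgrPdist_lt : ca; exact.
    - by near: y; move/cvgrPdist_lt : cb; exact.
  move=> /nbhs_ballP[r r0 rP]; exists r => // y yx; apply: rP.
  by rewrite -ball_normE /= distrC.
have rU y : `|y - x| < r -> U y by move=> /rP[].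
(* The summand 1 makes the denominator positive even for u = v = 0 and the bound by r strict. *)
pose h := r / (1 + (`|u| + `|v|)).
have uv0 : 0 < 1 + (`|u| + `|v|) by rewrite ltr_pwDl// addr_ge0.
have h0 : 0 < h by rewrite divr_gt0.
have hr : h * (`|u| + `|v|) < r.
  by rewrite /h -mulrA gtr_pMr// mulrC ltr_pdivrMr// mul1r ltrDr.
have [y yr Ey] := Ck2_second_difference Cf rU h0 hr.
have hr' : h * (`|v| + `|u|) < r by rewrite [`|v| + _]addrC.
have [z zr Ez] := Ck2_second_difference Cf rU h0 hr'.
have ab : a y = b z.
  have hh : h * h != 0 by rewrite mulf_neq0// gt_eqF.
  apply: (mulfI hh); rewrite -Ey -Ez [x + h *: v + _]addrAC.
  set p := f _; set q := f _; set s := f _; set t := f _; ring.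
have [_ ay _] := rP y yr; have [_ _ bz] := rP z zr.
rewrite (_ : a x - b x = (a x - a y) - (b x - b z)); last by rewrite ab; ring.
rewrite (le_trans (ler_normB _ _))// (splitr e) lerD// ltW//.
Unshelve. all: by end_near. Qed.

Lemma mx_norm_le m n (A : 'M[R]_(m, n)) (e : R) : 0 <= e ->
  (forall i j, `|A i j| <= e) -> `|A| <= e.
Proof.
move=> e0 Ae; rewrite /Num.Def.normr /= mx_normrE.
by apply: bigmax_le => // -[i j] _; exact: Ae.
Qed.

Lemma mx_norm_entry m n (A : 'M[R]_(m, n)) i j : `|A i j| <= `|A|.
Proof.
rewrite [leRHS]/Num.Def.normr /= mx_normrE.
exact: (le_bigmax _ (fun ij : 'I_m * 'I_n => `|A ij.1 ij.2|) (i, j)).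
Qed.

Definition jac n p (f : 'cV[R]_n -> 'cV[R]_p) x : 'M[R]_(p, n) :=
  \matrix_(i, j) 'd f x (delta_mx j 0) i 0.

Lemma jacE n p (f : 'cV[R]_n -> 'cV[R]_p) x v : 'd f x v = jac f x *m v.
Proof.
rewrite {1}(matrix_sum_delta v) linear_sum /=.
apply/matrixP => i j; rewrite ord1 summxE !mxE; apply: eq_bigr => k _.
by rewrite big_ord1 linearZ /= !mxE mulrC.
Qed.

Lemma diff_coord n p (f : 'cV[R]_n -> 'cV[R]_p) x v i :
  'd f x v i 0 = \sum_k 'd f x (delta_mx k 0) i 0 * v k 0.
Proof. by rewrite jacE !mxE; apply: eq_bigr => k _; rewrite !mxE. Qed.

(** Increments between any two points near x0 are compared with the one differential at x0,
    uniformly; this is what a contraction argument needs. *)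
Lemma strict_differentiable n p (U : set 'cV[R]_n) (f : 'cV[R]_n -> 'cV[R]_p) x0 :
  open U -> Ck 1 U f -> U x0 -> forall e : R, 0 < e ->
  exists2 r : R, 0 < r & forall x y, `|x - x0| < r -> `|y - x0| < r ->
    `|f x - f y - 'd f x0 (x - y)| <= e * `|x - y|.
Proof.
move=> oU [df Cdf] Ux0 e e0.
(* The error is shared among n partial derivatives; [n.+1] also covers n = 0. *)
pose e' := e / n.+1%:R.
have e'0 : 0 < e' by rewrite divr_gt0.
have [r r0 rP] : exists2 r : R, 0 < r & forall y, `|y - x0| < r ->
   U y /\ forall j, `|'d f y (delta_mx j 0) - 'd f x0 (delta_mx j 0)| <= e'.
  have : \forall y \near x0, U y /\
      forall j, `|'d f y (delta_mx j 0) - 'd f x0 (delta_mx j 0)| <= e'.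
    apply: filterI; first exact: open_nbhs_nbhs.
    pose P (j : 'I_n) (y : 'cV[R]_n) := `|'d f y (delta_mx j 0) - 'd f x0 (delta_mx j 0)| <= e'.
    apply: (@filter_forall _ _ P (nbhs x0)) => j; rewrite /P.
    have C : {for x0, continuous (fun y => 'd f y (delta_mx j 0))} by exact: Cdf.
    near=> y; rewrite distrC; near: y.
    by move/cvgrPdist_le : C; exact.
  move=> /nbhs_ballP[r r0 rP]; exists r => // y yx; apply: rP.
  by rewrite -ball_normE /= distrC.
exists r => // x y xr yr.
apply: mx_norm_le => [|i j]; first by rewrite mulr_ge0// ltW.
(* The mean value theorem is scalar, so it is applied to each entry, with an intermediate point
   depending on i. *)
rewrite ord1 {j}.
have seg (s : R) : 0 <= s <= 1 -> `|y + s *: (x - y) - x0| < r.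
  move=> /andP[s0 s1].
  rewrite (_ : _ - x0 = (1 - s) *: (y - x0) + s *: (x - x0)); last first.
    by apply/matrixP => a b; rewrite !mxE; ring.
  rewrite (le_lt_trans (ler_normD _ _))// !normrZ !ger0_norm ?subr_ge0//.
  have [->|s0'] := eqVneq s 0; first by rewrite subr0 mul1r mul0r addr0.
  have {}s0 : 0 < s by rewrite lt_neqAle eq_sym s0'.
  rewrite [ltRHS](_ : r = (1 - s) * r + s * r); last by ring.
  by rewrite ler_ltD// ?ler_wpM2l ?subr_ge0 ?ltr_pM2l// ltW.
have dfi z : `|z - x0| < r -> is_diff z (fun z => f z i 0) (fun v => 'd f z v i 0).
  by move=> /rP[Uz _]; apply: diff_entry; exact: df.
have [s s01 Es] : exists2 s : R, 0 <= s <= 1 &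
   f (y + (x - y)) i 0 - f y i 0 = 'd (fun z => f z i 0) (y + s *: (x - y)) (x - y).
  by apply: (@MVT_line _ (fun z => f z i 0)) => s /seg/dfi[].
have [_ dE] := dfi _ (seg s s01); rewrite dE in Es.
have yxy : y + (x - y) = x by rewrite addrC subrK.
rewrite yxy in Es.
pose a k := 'd f (y + s *: (x - y)) (delta_mx k 0) i 0.
pose b k := 'd f x0 (delta_mx k 0) i 0.
have -> : (f x - f y - 'd f x0 (x - y)) i 0 = \sum_k (a k - b k) * (x - y) k 0.
  have -> : (f x - f y - 'd f x0 (x - y)) i 0 =
      f x i 0 - f y i 0 - 'd f x0 (x - y) i 0 by rewrite !mxE.
  under eq_bigr do rewrite mulrBl.
  rewrite sumrB; congr (_ - _); last exact: diff_coord.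
  by apply: etrans Es _; exact: diff_coord.
rewrite (le_trans (ler_norm_sum _ _ _))//.
rewrite (@le_trans _ _ (\sum_(k < n) e' * `|x - y|))//.
  apply: ler_sum => k _; rewrite normrM.
  apply: ler_pM => //; last exact: mx_norm_entry.
  have [_ /(_ k) /(le_trans _)] := rP _ (seg s s01); apply.
  by have := mx_norm_entry ('d f (y + s *: (x - y)) (delta_mx k 0) - 'd f x0 (delta_mx k 0)) i 0;
     rewrite !mxE.
rewrite sumr_const card_ord -mulr_natl mulrA ler_wpM2r//.
rewrite /e' mulrCA ler_piMr// ?(ltW e0)// ler_pdivrMr// mul1r ler_nat//.
Unshelve. all: by end_near. Qed.

Lemma unitmx_inj n (M : 'M[R]_n) :
  (forall v : 'cV[R]_n, M *m v = 0 -> v = 0) -> M \in unitmx.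
Proof.
move=> Minj; rewrite -unitmx_tr -row_free_unit -kermx_eq0.
apply/negPn/negP => /rowV0Pn[u /sub_kermxP uM].
by rewrite -trmx_eq0 (Minj u^T) ?eqxx// -[M]trmxK -trmx_mul uM trmx0.
Qed.

Lemma inverse_function n (U : set 'cV[R]_n) (f : 'cV[R]_n -> 'cV[R]_n) x0 :
  open U -> Ck 1 U f -> U x0 -> (forall v, 'd f x0 v = 0 -> v = 0) ->
  exists r s : R, [/\ 0 < r, 0 < s, forall x, `|x - x0| < r -> U x,
    forall x y, `|x - x0| < r -> `|y - x0| < r -> f x = f y -> x = y &
    exists g, forall u, `|u - f x0| < s ->
      [/\ `|g u - x0| < r, f (g u) = u & {for u, continuous g}]].
Proof.
move=> oU Cf Ux0 dfinj.
pose M := jac f x0.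
have Mu : M \in unitmx by apply: unitmx_inj => v; rewrite -jacE; exact: dfinj.
pose B : {linear 'cV[R]_n -> 'cV[R]_n} := mulmx (invmx M).
have BK v : B ('d f x0 v) = v by rewrite jacE /B /= mulKmx.
have B0 v : B v = 0 -> v = 0.
  by move=> /(congr1 (mulmx M)); rewrite /B /= mulmx0 mulKVmx.
have [K K0 BKn] := linear_lipschitz (@mx_linear_continuous _ _ _ _ B).
(* K bounds the inverse differential B, so this error becomes 1/2 once B is applied. *)
have e0 : 0 < (2 * K)^-1 by rewrite invr_gt0 mulr_gt0.
have [d1 d10 strict1] := strict_differentiable oU Cf Ux0 e0.
have [d2 d20 d2U] := open_normP oU Ux0.
pose d := Num.min d1 d2.
have d0 : 0 < d by rewrite lt_min d10.
have strict x y : `|x - x0| < d -> `|y - x0| < d ->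
    `|B (f x - f y) - (x - y)| <= `|x - y| / 2.
  rewrite !lt_min => /andP[xd _] /andP[yd _].
  have -> : B (f x - f y) - (x - y) = B (f x - f y - 'd f x0 (x - y)).
    by rewrite [RHS](linearB B) BK.
  rewrite (le_trans (BKn _))//.
  rewrite (le_trans (ler_wpM2l (ltW K0) (strict1 x y xd yd)))//.
  by rewrite mulrA invfM mulrCA mulfV ?gt_eqF// mulr1 mulrC.
(* This estimate gives both the injectivity of f and the continuity of its inverse. *)
have expand x y : `|x - x0| < d -> `|y - x0| < d ->
    `|x - y| <= 2 * K * `|f x - f y|.
  move=> xd yd; have := strict x y xd yd.
  have := BKn (f x - f y); have := ler_normD (B (f x - f y)) (- (B (f x - f y) - (x - y))).
  rewrite normrN opprB addrC subrK; lra.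
(* For u this close to [f x0], the map T below moves x0 by at most d/4. As it contracts by 1/2, it
   sends the ball of radius d/2 into itself. *)
exists d, (d / (4 * K)).
have s0 : 0 < d / (4 * K) by rewrite divr_gt0// mulr_gt0.
split => //.
- by move=> x; rewrite lt_min => /andP[_ /d2U].
- move=> x y xd yd fxy; have := expand x y xd yd.
  by rewrite fxy subrr normr0 mulr0 normr_le0 subr_eq0 => /eqP.
have solve u : `|u - f x0| < d / (4 * K) -> exists x, `|x - x0| < d /\ f x = u.
  move=> ud; pose C := [set x : 'cV[R]_n | `|x - x0| <= d / 2].
  have Cd x : C x -> `|x - x0| < d.
    by move=> /le_lt_trans; apply; rewrite ltr_pdivrMr// ltr_pMr// ltr1n.
  have x0d : `|x0 - x0| < d by rewrite subrr normr0.
  (* Newton's iteration with the differential frozen at x0; a fixed point solves [f x = u] because B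
     is injective. *)
  pose T x := x - B (f x - u).
  have TL x y : `|x - x0| < d -> `|y - x0| < d -> `|T x - T y| <= 2^-1 * `|x - y|.
    move=> xd yd; have := strict x y xd yd; rewrite mulrC.
    rewrite -normrN; congr (`|_| <= _).
    rewrite /T opprB opprB [in RHS]addrAC [RHS]addrC !addrA.
    have -> : f x - f y = (f x - u) - (f y - u) by rewrite opprB addrA subrK.
    rewrite linearB /=; set p := B _; set q := B _.
    by apply/matrixP => a b; rewrite !mxE; ring.
  have CT : set_fun C C T.
    move=> x Cx; rewrite /C /=.
    have := TL x x0 (Cd x Cx) x0d; rewrite /C /= in Cx.
    have : `|T x0 - x0| <= K * `|u - f x0|.
      by rewrite /T addrAC subrr add0r normrN -[in leRHS]normrN opprB; exact: BKn.
    have : K * `|u - f x0| <= d / 4.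
      by rewrite mulrC -ler_pdivlMr// (le_trans (ltW ud))// invfM mulrA.
    have := ler_normD (T x - T x0) (T x0 - x0); rewrite subrKA.
    by move: Cx; lra.
  pose TF : {fun C >-> C} := HB.pack T (isFun.Build _ _ _ _ T CT).
  have ctr : is_contraction TF.
    exists (2^-1)%:nng; split => /=; first by rewrite invf_lt1// ltr1n.
    by move=> [x y] [/= /Cd xd /Cd yd]; exact: TL.
  have clC : closed C.
    have -> : C = closed_ball x0 (d / 2).
      rewrite closed_ballE ?divr_gt0//.
      by apply/seteqP; split => x; rewrite /C /closed_ball_ /= distrC.
    exact: closed_ball_closed.
  have C0 : C !=set0 by exists x0; rewrite /C /= subrr normr0 divr_ge0// ltW.
  have [x Cx xT] := banach_fixed_point ctr clC C0.
  exists x; split; first exact: Cd.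
  apply/eqP; rewrite -subr_eq0; apply/eqP/B0.
  by apply: (addrI (x - B (f x - u))); rewrite subrK addr0 -[RHS]/(TF x).
pose g u := if pselect (`|u - f x0| < d / (4 * K)) is left H
            then projT1 (cid (solve u H)) else x0.
exists g.
have gP u : `|u - f x0| < d / (4 * K) -> `|g u - x0| < d /\ f (g u) = u.
  by move=> ud; rewrite /g; case: pselect => // H; case: cid.
move=> u ud; have [gud fgu] := gP u ud; split => //.
apply/(@cvgrPdist_le _ _ _ (nbhs u)) => e e_gt0.
near=> w.
have wd : `|w - f x0| < d / (4 * K).
  near: w; have op : open [set w : 'cV[R]_n | `|w - f x0| < d / (4 * K)].
    rewrite (_ : [set _ | _] = ball (f x0) (d / (4 * K))); first exact: ball_open.
    by apply/seteqP; split => w; rewrite -ball_normE /= distrC.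
  exact: (open_nbhs_nbhs (conj op ud)).
have [gwd fgw] := gP w wd.
rewrite (le_trans (expand _ _ gud gwd))// fgu fgw.
rewrite mulrC -ler_pdivlMr ?mulr_gt0//.
near: w; have := @cvg_id _ (nbhs u); move=> /cvgrPdist_le; apply.
by rewrite divr_gt0 ?mulr_gt0.
Unshelve. all: by end_near. Qed.

End InverseFunction.

(** * The transverse Nijenhuis component as a function of the jet *)

(* Indices of the coordinates along and transverse to the slice. *)
Notation ti k := (lshift 2 (k : 'I_2)).
Notation ni k := (rshift 2 (k : 'I_2)).
Notation evec i := (delta_mx i 0).

Section Nijenhuis.
Context {R : realType}.
Notation idx := 'I_(2 + 2).

(* The term [(s, ((p, q), (i, (r, c))))] stands for [s * A p q * d_i (A r c)].
   At points of L, where the lower left block of [A] vanishes, the terms add up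
   to an entry of the component of the Nijenhuis tensor transverse to L, paired
   with the first coordinate vector along L; see [nijenhuis_mx]. *)
Definition nij_terms : seq (R * ((idx * idx) * (idx * (idx * idx)))) :=
  [seq t | k <- enum 'I_2, t <-
    [:: (1, ((ni 0, ni k), (ni 1, (ni k, ti 0))));
        (-1, ((ni k, ni 1), (ni k, (ni 0, ti 0))));
        (-1, ((ni 0, ni k), (ti 0, (ni k, ni 1))));
        (1, ((ti k, ti 0), (ti k, (ni 0, ni 1))))]].

Definition nij_sum (Q : (idx * idx) * (idx * (idx * idx)) -> R) : R :=
  \sum_(t <- nij_terms) t.1 * Q t.2.

Lemma nij_sumE Q : nij_sum Q = \sum_(k < 2)
  (Q ((ni 0, ni k), (ni 1, (ni k, ti 0))) - Q ((ni k, ni 1), (ni k, (ni 0, ti 0)))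
   - Q ((ni 0, ni k), (ti 0, (ni k, ni 1))) + Q ((ti k, ti 0), (ti k, (ni 0, ni 1)))).
Proof.
rewrite /nij_sum big_allpairs_dep /= big_enum /=; apply: eq_bigr => k _.
by rewrite !big_cons big_nil /= !mul1r !mulN1r addr0 !addrA.
Qed.

Definition nijenhuis (A : 'cV[R]_(2 + 2) -> 'M[R]_(2 + 2)) (y : 'cV[R]_(2 + 2)) : R :=
  nij_sum (fun t => A y t.1.1 t.1.2 *
    'D_(evec t.2.1) (fun z => A z t.2.2.1 t.2.2.2) y).

Lemma smooth_nijenhuis U A : open U -> smooth_on U A -> smooth_on U (nijenhuis A).
Proof.
move=> oU sA; apply: smooth_sum => // t; apply: smoothZ => //.
apply: smoothM => // [k|]; first exact: Ck_entry.
by apply: smooth_derive => // k; exact: Ck_entry.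
Qed.

(** Exponents are plain functions, easy to compute with, and [inord] brings them back to the bounded
    type. The value is meaningful for orders up to m, as [jet_coordE] requires; the default 0 is met
    only beyond. *)
Definition jet_coord m (a : idx -> nat) (p q : idx) (j : jet_space R m) : R :=
  if insub [ffun i => inord (a i) : 'I_m.+1] is Some al
  then j (enum_rank (al : multi_index m)) (mxvec_index p q) else 0.

Lemma jet_coordE m a p q A y : (\sum_i a i <= m)%N ->
  jet_coord a p q (jet m A y) = mderiv a A y p q.
Proof.
move=> am; have aE i : (inord (a i) : 'I_m.+1) = a i :> nat.
  rewrite inordK// ltnS (leq_trans _ am)//.
  by rewrite (bigD1 i)//= leq_addr.
rewrite /jet_coord insubT => [|a_le].
  by under eq_bigr do rewrite ffunE aE.
rewrite !mxE enum_rankK mxvecE; congr (mderiv _ A y p q).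
by apply/funext => i; rewrite SubK ffunE aE.
Qed.

Lemma smooth_jet_coord m a p q :
  smooth_on setT (jet_coord (m := m) a p q).
Proof.
move=> k; rewrite /jet_coord; case: insub => [al|]; last by apply: Ck_cst; exact: openT.
by apply: (Ck_entry (f := id)); [exact: openT|exact/Ck_id/openT].
Qed.

Definition tpow (l : nat) (i : idx) : nat := if i == ti 0 then l else 0%N.

Lemma enum_idx : enum 'I_(2 + 2) = [:: ti 0; ti 1; ni 0; ni 1].
Proof.
by apply: (inj_map val_inj); rewrite val_enum_ord.
Qed.

(** The index [ti 0] heads the enumeration, so [foldr] applies its derivatives outermost. Here and
    in [mderiv_tpowD] no partial derivatives have to be exchanged. *)
Lemma mderiv_tpow (E : normedModType R) l (f : 'cV[R]_(2 + 2) -> E) :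
  mderiv (tpow l) f = iter l (fun g => 'D_(evec (ti 0)) g) f.
Proof. by rewrite /mderiv enum_idx. Qed.

Lemma mderiv_tpowD (E : normedModType R) l i (f : 'cV[R]_(2 + 2) -> E) :
  mderiv (fun k => tpow l k + (k == i))%N f =
  iter l (fun g => 'D_(evec (ti 0)) g) ('D_(evec i) f).
Proof.
have : i \in enum 'I_(2 + 2) by rewrite mem_enum.
rewrite /mderiv enum_idx !inE => /or4P[] /eqP->.
- by rewrite /= addn1 -iterSr.
- by rewrite /= addn0.
- by rewrite /= addn0.
- by rewrite /= addn0.
Qed.

Lemma sum_tpow l : (\sum_i tpow l i)%N = l.
Proof.
rewrite (bigD1 (ti 0))//= big1 /tpow ?eqxx ?addn0// => i /negbTE->.
by [].
Qed.

Lemma sum_tpowD l i : (\sum_k (tpow l k + (k == i)))%N = l.+1.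
Proof.
rewrite big_split /= sum_tpow (bigD1 i)//= eqxx big1 ?addn0 ?addn1// => k /negbTE->.
by [].
Qed.

(** Leibniz' rule for the k-th derivative of [nijenhuis], with every derivative of A replaced by a
    jet coordinate: a polynomial on the jet space. *)
Definition nij_jet m k (j : jet_space R m) : R :=
  nij_sum (fun t => \sum_(l < k.+1) 'C(k, l)%:R *
    (jet_coord (tpow l) t.1.1 t.1.2 j *
     jet_coord (fun i => tpow (k - l) i + (i == t.2.1))%N t.2.2.1 t.2.2.2 j)).

Lemma nij_jetE m k U A y : open U -> U y -> smooth_on U A -> (k < m)%N ->
  nij_jet k (jet m A y) = iter k (fun g => 'D_(evec (ti 0)) g) (nijenhuis A) y.
Proof.
move=> oU Uy sA km.
have sAe p q : smooth_on U (fun z => A z p q) by move=> i; exact: Ck_entry.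
have sDA i p q : smooth_on U ('D_(evec i) (fun z => A z p q)).
  exact: smooth_derive.
rewrite [RHS](@iter_derive_sum _ _ U); last exact: Uy; last 2 first.
- exact: oU.
- by move=> t; apply: smoothZ => //; apply: smoothM.
apply: eq_bigr => -[s [[p q] [i [r c]]]] _ /=.
rewrite [RHS](iter_deriveZ s _ _ oU _ Uy); last by apply: smoothM.
congr (_ * _); rewrite [RHS](iter_deriveM _ _ oU (sAe _ _) (sDA _ _ _) Uy).
apply: eq_bigr => l _.
have lk : (l <= k)%N by rewrite -ltnS.
congr (_ * (_ * _)).
  rewrite jet_coordE ?sum_tpow ?(leq_trans lk (ltnW km))//.
  by rewrite mderiv_tpow (iter_derive_entry _ _ _ _ oU sA Uy).
(* The tensor has one derivative of its own, so the order is [(k - l).+1]; hence the assumption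
   [k < m]. *)
rewrite jet_coordE ?sum_tpowD ?(leq_ltn_trans (leq_subr _ _) km)//.
rewrite mderiv_tpowD (iter_derive_entry _ _ _ _ oU (smooth_derive _ oU sA) Uy).
have E z : U z -> 'D_(evec i) A z r c = 'D_(evec i) (fun z => A z r c) z.
  by move=> Uz; rewrite (derive_entry _ _ _ sA Uz).
elim: (k - l)%N y Uy => [|n IH] y Uy /=; first exact: E.
exact: derive_eq_on Uy.
Qed.

Definition nij_jets m (j : jet_space R m) : 'cV[R]_m := \col_(k < m) nij_jet k j.

Lemma smooth_nij_jets m : smooth_on setT (@nij_jets m).
Proof.
have oT := @openT (jet_space R m).
move=> n; apply: Ck_mx => // i j.
have -> : (fun x => nij_jets x i j) = nij_jet i by apply/funext => x; rewrite mxE.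
move: n; apply: smooth_sum => // t; apply: smoothZ => //.
apply: smooth_sum => // l; apply: smoothZ => //.
by apply: smoothM => //; exact: smooth_jet_coord.
Qed.

End Nijenhuis.

(** * Deformations of almost complex structures *)

Section Deformation.
Context {R : realType}.
Notation idx := 'I_(2 + 2).

Lemma iter_derive_eq_on (E F : normedModType R) (U : set E) (f g : E -> F) v l : open U ->
  (forall x, U x -> f x = g x) ->
  forall x, U x -> iter l (fun h => 'D_v h) f x = iter l (fun h => 'D_v h) g x.
Proof.
by move=> oU fg; elim: l => [|l IH] //= x Ux; exact: derive_eq_on Ux.
Qed.

Lemma mderiv_lin (E : normedModType R) (U : set 'cV[R]_(2 + 2)) a
    (f g : 'cV[R]_(2 + 2) -> E) (s : R) :
  open U -> smooth_on U f -> smooth_on U g -> forall y, U y ->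
  mderiv a (fun z => f z + s *: g z) y = mderiv a f y + s *: mderiv a g y.
Proof.
move=> oU sf sg; rewrite /mderiv.
pose D r h := foldr (fun i => iter (a i) (pderiv i)) h r : 'cV[R]_(2 + 2) -> E.
have sD r h : smooth_on U h -> smooth_on U (D r h).
  by move=> sh; elim: r => //= i r IH; exact: smooth_iter_derive.
elim: (enum _) => //= i r IH y Uy.
rewrite (iter_derive_eq_on _ (a i) oU IH Uy).
rewrite (iter_deriveD _ _ oU (sD r _ sf) (smoothZ s oU (sD r _ sg)) Uy).
by rewrite (iter_deriveZ s _ _ oU (sD r _ sg) Uy).
Qed.

Lemma jet_lin m (U : set 'cV[R]_(2 + 2)) f g (s : R) y :
  open U -> smooth_on U f -> smooth_on U g -> U y ->
  jet m (fun z => f z + s *: g z) y = jet m f y + s *: jet m g y.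
Proof.
move=> oU sf sg Uy; apply/matrixP => i j.
rewrite /jet !mxE (mderiv_lin _ s oU sf sg Uy).
by case/mxvec_indexP: j => p q; rewrite !mxvecE !mxE.
Qed.

Lemma smooth_coord (E : normedModType R) (U : set E) m n (f : E -> 'M[R]_(m, n)) i j :
  open U -> smooth_on U f -> smooth_on U (fun x => f x i j).
Proof. by move=> oU sf k; exact: Ck_entry. Qed.

Lemma smooth_mxM (E : normedModType R) (U : set E) m n p
    (f : E -> 'M[R]_(m, n)) (g : E -> 'M[R]_(n, p)) :
  open U -> smooth_on U f -> smooth_on U g -> smooth_on U (fun x => f x *m g x).
Proof.
move=> oU sf sg k; apply: Ck_mx => // i j.
have -> : (fun x => (f x *m g x) i j) = (fun x => \sum_l f x i l * g x l j).
  by apply/funext => x; rewrite mxE.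
by move: k; apply: smooth_sum => // l; apply: smoothM => //; exact: smooth_coord.
Qed.

Lemma smooth_cst (E F : normedModType R) (U : set E) (a : F) :
  open U -> smooth_on U (fun=> a).
Proof. by move=> oU k; exact: Ck_cst. Qed.

Lemma smoothX (E : normedModType R) (U : set E) (f : E -> R) n :
  open U -> smooth_on U f -> smooth_on U (fun x => f x ^+ n).
Proof.
move=> oU sf; elim: n => [|n IH]; first exact: smooth_cst.
have -> : (fun x => f x ^+ n.+1) = (fun x => f x * f x ^+ n).
  by apply/funext => x; rewrite exprS.
exact: smoothM.
Qed.

Lemma smooth_scale (E : normedModType R) (U : set E) m n
   (f : E -> R) (g : E -> 'M[R]_(m, n)) :
  open U -> smooth_on U f -> smooth_on U g -> smooth_on U (fun x => f x *: g x).
Proof.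
move=> oU sf sg k; apply: Ck_mx => // i j.
have -> : (fun x => (f x *: g x) i j) = (fun x => f x * g x i j).
  by apply/funext => x; rewrite mxE.
by move: k; apply: smoothM => //; exact: smooth_coord.
Qed.

(** These functions are dual to the derivatives in the direction [ti 0] at y0; see
    [iter_derive_taylor]. *)
Definition taylor (y0 : 'cV[R]_(2 + 2)) n (y : 'cV[R]_(2 + 2)) : R :=
  (n`!%:R)^-1 * (y (ti 0) 0 - y0 (ti 0) 0) ^+ n.

Lemma smooth_taylor U y0 n : open U -> smooth_on U (taylor y0 n).
Proof.
move=> oU; apply: smoothZ => //; apply: smoothX => //.
apply: smoothD => //; last exact: smooth_cst.
by apply: smooth_coord => // k; exact: Ck_id.
Qed.

Lemma is_derive_coord (i j : idx) (y : 'cV[R]_(2 + 2)) :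
  is_derive y (evec i) (fun z : 'cV[R]_(2 + 2) => z j 0) (j == i)%:R.
Proof.
have [did didE] := is_diff_id y.
have [de deE] := diff_entry j 0 did; apply: DeriveDef; first exact: diff_derivable.
by rewrite deriveE// deE didE !mxE andbT.
Qed.

Lemma is_derive_coordB (i j : idx) (y : 'cV[R]_(2 + 2)) (c : R) :
  is_derive y (evec i) (fun z : 'cV[R]_(2 + 2) => z j 0 - c) (j == i)%:R.
Proof.
have := is_deriveB (is_derive_coord i j y) (is_derive_cst c y (evec i)).
by rewrite subr0.
Qed.

Lemma derive_taylor y0 n :
  'D_(evec (ti 0)) (taylor y0 n) = if n is n'.+1 then taylor y0 n' else 0.
Proof.
apply/funext => y.
have [_ dT] := is_deriveZ ((n`!%:R)^-1 : R)
  (is_deriveX n (is_derive_coordB (ti 0) (ti 0) y (y0 (ti 0) 0))).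
have -> : taylor y0 n = (n`!%:R)^-1 \*: ((fun z : 'cV_(2 + 2) => z (ti 0) 0 - y0 (ti 0) 0) ^+ n).
  by apply/funext => z; rewrite /= exprfctE.
rewrite dT eqxx /GRing.scale /= mulr1.
case: n {dT} => [|n]; first by rewrite mul0r mulr0.
rewrite /taylor /= mulrA; congr (_ * _).
by rewrite factS natrM invfM mulrAC mulVf ?mul1r// pnatr_eq0.
Qed.

Lemma iter_derive_taylor y0 n k :
  iter k (fun g => 'D_(evec (ti 0)) g) (taylor y0 n) y0 = (n == k)%:R.
Proof.
have T0 l : iter l (fun g => 'D_(evec (ti 0)) g) 0 = 0 :> ('cV[R]_(2 + 2) -> R).
  by elim: l => //= l ->; apply/funext => y; exact: derive_cst.
elim: k n => [|k IH] [|n].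
- by rewrite /= /taylor expr0 fact0 invr1 mulr1.
- by rewrite /= /taylor subrr expr0n mulr0.
- by rewrite iterSr derive_taylor T0.
- by rewrite iterSr derive_taylor IH.
Qed.

(** It sends the second tangent direction to the second transverse one. A product with it on the
    right lives in column [ti 1], the column that no entry in [nij_terms] uses, so only the product
    on the left matters. *)
Definition gauge_dir : 'M[R]_(2 + 2) := delta_mx (ni 1) (ti 1).

(* Expansion in [s] of the conjugate of [A] by [1 + s b gauge_dir]. *)
Definition gauge1 (b : 'cV[R]_(2 + 2) -> R) A (y : 'cV[R]_(2 + 2)) : 'M[R]_(2 + 2) :=
  b y *: (A y *m gauge_dir - gauge_dir *m A y).

Definition gauge2 (b : 'cV[R]_(2 + 2) -> R) A (y : 'cV[R]_(2 + 2)) : 'M[R]_(2 + 2) :=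
  - (b y * b y) *: (gauge_dir *m A y *m gauge_dir).

Definition gauge b A (s : R) y := A y + s *: gauge1 b A y + (s * s) *: gauge2 b A y.

Lemma gauge_conj b A s y : gauge b A s y =
  (1%:M - (s * b y) *: gauge_dir) *m A y *m (1%:M + (s * b y) *: gauge_dir).
Proof.
rewrite /gauge /gauge1 /gauge2 mulmxDr mulmx1 mulmxBl mul1mx -scalemxAl.
rewrite -scalemxAr mulmxBl -scalemxAl.
move: (A y *m _) (gauge_dir *m A y) (gauge_dir *m _ *m _) => AD DA DAD.
by apply/matrixP => i j; rewrite !mxE; ring.
Qed.

Lemma gauge_dir_sq : gauge_dir *m gauge_dir = 0.
Proof. by rewrite /gauge_dir mul_delta_mx_0. Qed.

Lemma gauge_inv (s : R) : (1%:M + s *: gauge_dir) *m (1%:M - s *: gauge_dir) = 1%:M.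
Proof.
rewrite mulmxDl !mulmxBr !mul1mx !mulmx1 -scalemxAl -scalemxAr gauge_dir_sq.
by rewrite !scaler0 subr0 subrK.
Qed.

Lemma gauge_inv' (s : R) : (1%:M - s *: gauge_dir) *m (1%:M + s *: gauge_dir) = 1%:M.
Proof. by have := gauge_inv (- s); rewrite !scaleNr opprK. Qed.

Lemma gauge_sq b A s y : A y *m A y = - 1%:M ->
  gauge b A s y *m gauge b A s y = - 1%:M.
Proof.
move=> AA; rewrite !gauge_conj; set p := s * b y.
set P := _ - _; set Q := 1%:M + _.
have -> : P *m A y *m Q *m (P *m A y *m Q) = P *m (A y *m (Q *m P) *m A y) *m Q.
  by rewrite !mulmxA.
by rewrite gauge_inv mulmx1 AA mulmxN mulmx1 mulNmx gauge_inv'.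
Qed.

Lemma smooth_gauge1 U b A : open U -> smooth_on U b -> smooth_on U A ->
  smooth_on U (gauge1 b A).
Proof.
move=> oU sb sA; apply: smooth_scale => //.
have -> : (fun x => A x *m gauge_dir - gauge_dir *m A x) =
          (fun x => A x *m gauge_dir + (-1) *: (gauge_dir *m A x)).
  by apply/funext => x; rewrite scaleN1r.
by apply: smoothD => //; [|apply: smoothZ => //]; apply: smooth_mxM => //; exact: smooth_cst.
Qed.

Lemma smooth_gauge2 U b A : open U -> smooth_on U b -> smooth_on U A ->
  smooth_on U (gauge2 b A).
Proof.
move=> oU sb sA; apply: smooth_scale => //.
  have -> : (fun x => - (b x * b x)) = (fun x => -1 * (b x * b x)).
    by apply/funext => x; rewrite mulN1r.
  by apply: smoothZ => //; exact: smoothM.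
by apply: smooth_mxM => //; [apply: smooth_mxM => //|]; exact: smooth_cst.
Qed.

Lemma smooth_gauge U b A s : open U -> smooth_on U b -> smooth_on U A ->
  smooth_on U (gauge b A s).
Proof.
move=> oU sb sA; apply: smoothD => //; last by apply: smoothZ => //; exact: smooth_gauge2.
by apply: smoothD => //; apply: smoothZ => //; exact: smooth_gauge1.
Qed.

Lemma delta_mulmx_entry a n l (B : 'M[R]_(n, l)) (p i : 'I_a) (q : 'I_n) j :
  (delta_mx p q *m B) i j = (i == p)%:R * B q j.
Proof.
rewrite mxE (bigD1 q)//= big1 ?addr0 ?mxE ?eqxx ?andbT// => k /negbTE kq.
by rewrite mxE kq andbF mul0r.
Qed.

Lemma mulmx_delta_entry a n l (B : 'M[R]_(a, n)) (p : 'I_n) (q j : 'I_l) i :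
  (B *m delta_mx p q) i j = B i p * (j == q)%:R.
Proof.
rewrite mxE (bigD1 p)//= big1 ?addr0 ?mxE ?eqxx// => k /negbTE kq.
by rewrite mxE kq mulr0.
Qed.

Lemma gauge_entry b A s y (i j : idx) : j != ti 1 ->
  gauge b A s y i j = A y i j - s * (b y * ((i == ni 1)%:R * A y (ti 1) j)).
Proof.
move=> /negbTE j1.
have AD : (A y *m gauge_dir) i j = 0 by rewrite mulmx_delta_entry j1 mulr0.
have DAD : (gauge_dir *m A y *m gauge_dir) i j = 0.
  by rewrite mulmx_delta_entry j1 mulr0.
have DA : (gauge_dir *m A y) i j = (i == ni 1)%:R * A y (ti 1) j.
  exact: delta_mulmx_entry.
rewrite /gauge /gauge1 /gauge2; move: AD DAD DA.
move: (A y *m _) (gauge_dir *m A y) (gauge_dir *m _ *m _) => AD DA DAD.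
by rewrite !mxE => -> -> ->; ring.
Qed.

Lemma sum_I2 (F : 'I_2 -> R) : \sum_k F k = F 0 + F 1.
Proof.
by rewrite big_ord_recl big_ord1; congr (F _ + F _); exact: val_inj.
Qed.

Lemma derive_gauge_entry U b A s y v (i j : idx) : open U -> U y ->
  smooth_on U b -> smooth_on U A -> j != ti 1 -> b y = 0 ->
  'D_v (fun z => gauge b A s z i j) y = 'D_v (fun z => A z i j) y -
     s * ('D_v b y * ((i == ni 1)%:R * A y (ti 1) j)).
Proof.
move=> oU Uy sb sA j1 b0.
rewrite (derive_eq_on v oU (fun z _ => gauge_entry b A s z i j1) Uy).
have sh : smooth_on U (fun z => (i == ni 1)%:R * A z (ti 1) j).
  by apply: smoothZ => //; exact: smooth_coord.
have dA := smooth_derivable (v := v) (smooth_coord i j oU sA) Uy.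
have dh := smooth_derivable (v := v) sh Uy.
have db := smooth_derivable (v := v) sb Uy.
have dM := derivableM db dh.
rewrite [LHS](deriveB dA (derivableZ (k := s) dM)) (deriveZ s dM) (deriveM db dh).
by rewrite b0 scale0r add0r /GRing.scale /= [X in _ - _ * X]mulrC.
Qed.

(** Only the term with [A (ni 0) (ni 1)] and the derivative of [A (ni 1) (ti 0)] in direction [ni 1]
    changes. The others differentiate the row [ni 0], which is kept, or differentiate in direction
    [ti 0], where b has derivative zero. *)
Lemma nijenhuis_gauge U b A s y p : open U -> U y ->
  smooth_on U b -> smooth_on U A -> b y = 0 ->
  'D_(evec (ti 0)) b y = 0 -> 'D_(evec (ni 1)) b y = p ->
  nijenhuis (gauge b A s) y =
  nijenhuis A y - s * (p * (A y (ni 0) (ni 1) * A y (ti 1) (ti 0))).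
Proof.
move=> oU Uy sb sA b0 Dt Dn; rewrite /nijenhuis !nij_sumE !sum_I2 /=.
rewrite !gauge_entry// !(derive_gauge_entry _ _ _ oU Uy sb sA)// b0 Dt Dn.
rewrite (_ : ni 0 == ni 1 = false)// (_ : ti 0 == ni 1 = false)// (_ : ti 1 == ni 1 = false)//.
rewrite ?eqxx !(mulr0n, mulr1n, mul0r, mul1r, mulr0, subr0) -[RHS]addrA; congr (_ + _).
have aux (a d c y2 y3 y4 : R) : a * (d - s * (p * c)) - y2 - y3 + y4 =
  a * d - y2 - y3 + y4 - s * (p * (a * c)) by ring.
exact: aux.
Qed.

End Deformation.

(** * Codimension *)

Section Codimension.
Context {R : realType}.
Notation idx := 'I_(2 + 2).

Lemma dsubmx_evec_ti k : dsubmx (evec (ti k) : 'cV[R]_(2 + 2)) = 0.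
Proof. by apply/matrixP => i j; rewrite !mxE eq_rlshift. Qed.

Lemma near_tangent_line (U : set 'cV[R]_(2 + 2)) y k : open U -> U y ->
  \forall t \near (0 : R), U (y + t *: evec (ti k)).
Proof.
move=> oU Uy; have Uy0 : nbhs (y + 0 *: evec (ti k)) U.
  by rewrite scale0r addr0; exact: open_nbhs_nbhs.
exact: (continuous_line Uy0).
Qed.

Lemma dsubmx_tangent_line (y : 'cV[R]_(2 + 2)) (t : R) k :
  dsubmx (y + t *: evec (ti k)) = dsubmx y.
Proof. by rewrite linearD linearZ /= dsubmx_evec_ti scaler0 addr0. Qed.

Lemma preserved_entry (B : 'M[R]_(2 + 2)) :
  (forall v : 'cV[R]_(2 + 2), dsubmx v = 0 -> dsubmx (B *m v) = 0) ->
  forall r k, B (ni r) (ti k) = 0.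
Proof.
move=> BL r k; have := BL _ (dsubmx_evec_ti k).
move=> /(congr1 (fun C : 'cV[R]_2 => C r 0)).
by rewrite [X in X = _ -> _]mxE mulmx_delta_entry eqxx mulr1 mxE.
Qed.

(** Both diagonal blocks have square -1. If such an off-diagonal entry vanished, a diagonal entry
    would be a real number of square -1. *)
Lemma preserved_neq0 (B : 'M[R]_(2 + 2)) : B *m B = - 1%:M ->
  (forall v : 'cV[R]_(2 + 2), dsubmx v = 0 -> dsubmx (B *m v) = 0) ->
  B (ti 1) (ti 0) != 0 /\ B (ni 0) (ni 1) != 0.
Proof.
move=> BB /preserved_entry B0.
have sq (i : idx) : \sum_(k < 2) B i (ti k) * B (ti k) i +
    \sum_(k < 2) B i (ni k) * B (ni k) i = -1.
  have := congr1 (fun C : 'M[R]_(2 + 2) => C i i) BB.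
  by rewrite !mxE big_split_ord /= eqxx.
have neg (t : R) : t * t = -1 -> False.
  by move=> tt; have := sqr_ge0 t; rewrite expr2 tt oppr_ge0 ler10.
split; apply/eqP => Bz.
  have := sq (ti 0); rewrite !sum_I2 !B0 Bz !mulr0 !addr0 => /neg; exact.
have := sq (ni 0); rewrite !sum_I2 !B0 Bz !mul0r !add0r addr0 => /neg; exact.
Qed.

Lemma open_neq0 (E : normedModType R) (V : set E) (h : E -> R) :
  open V -> smooth_on V h -> open (V `&` [set y | h y != 0]).
Proof.
move=> oV sh; rewrite openE => y [Vy hy]; apply: filterI.
  exact: open_nbhs_nbhs.
have ch : {for y, continuous h} := sh 0%N y Vy.
have : nbhs (h y) [set r : R | r != 0] by apply: open_nbhs_nbhs; split => //; exact: open_neq.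
exact: ch.
Qed.

(** * Varying the equations in a prescribed direction v *)

Section Variation.
Variables (m : nat) (V : set 'cV[R]_(2 + 2)) (A : 'cV[R]_(2 + 2) -> 'M[R]_(2 + 2)).
Variables (y0 : 'cV[R]_(2 + 2)) (v : 'cV[R]_m).
Hypotheses (oV : open V) (Vy0 : V y0) (sA : smooth_on V A).
Hypotheses (At : forall y, V y -> A y (ti 1) (ti 0) != 0).
Hypotheses (An : forall y, V y -> A y (ni 0) (ni 1) != 0).

Definition target y : R := \sum_(i < m) v i 0 * taylor y0 i y.

(** The transverse derivative b must have for the change in [nijenhuis_gauge] to be s times
    [target]. *)
Definition slope y := - (target y / (A y (ni 0) (ni 1) * A y (ti 1) (ti 0))).

(** The linear factor makes b and its derivative along [ti 0] vanish on a hyperplane, which will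
    contain L, while its derivative along [ni 1] there is [slope]. *)
Definition bump_fn (y : 'cV[R]_(2 + 2)) : R := (y (ni 1) 0 - y0 (ni 1) 0) * slope y.

Lemma smooth_target : smooth_on V target.
Proof. by apply: smooth_sum => // i; apply: smoothZ => //; exact: smooth_taylor. Qed.

Lemma iter_derive_target (k : 'I_m) :
  iter k (fun g => 'D_(evec (ti 0)) g) target y0 = v k 0.
Proof.
rewrite (@iter_derive_sum _ _ V) //; last by move=> i; apply: smoothZ => //; exact: smooth_taylor.
rewrite (bigD1 k)//= big1 => [|i ik].
  rewrite (iter_deriveZ _ _ _ oV (smooth_taylor y0 k oV) Vy0).
  by rewrite iter_derive_taylor eqxx addr0 [LHS]mulr1.
rewrite (iter_deriveZ _ _ _ oV (smooth_taylor y0 i oV) Vy0).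
by rewrite iter_derive_taylor (negbTE ik : (i == k :> nat) = false) [LHS]mulr0.
Qed.

Lemma smooth_slope : smooth_on V slope.
Proof.
have sAA : smooth_on V (fun y => A y (ni 0) (ni 1) * A y (ti 1) (ti 0)).
  by apply: smoothM => //; exact: smooth_coord.
have -> : slope = (fun y => -1 * (target y * (A y (ni 0) (ni 1) * A y (ti 1) (ti 0))^-1)).
  by apply/funext => y; rewrite mulN1r.
apply: smoothZ => //; apply: smoothM => //; first exact: smooth_target.
by move=> k; apply: CkV => // y Vy; rewrite mulf_neq0 ?At ?An.
Qed.

Lemma smooth_coordB (i : idx) (c : R) :
  smooth_on V (fun y : 'cV[R]_(2 + 2) => y i 0 - c).
Proof.
apply: smoothD => //; last exact: smooth_cst.
by apply: smooth_coord => // k; exact: Ck_id.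
Qed.

Lemma smooth_bump_fn : smooth_on V bump_fn.
Proof. by apply: smoothM => //; [exact: smooth_coordB|exact: smooth_slope]. Qed.

Lemma derive_bump_fn y i : V y -> y (ni 1) 0 = y0 (ni 1) 0 ->
  'D_(evec i) bump_fn y = (ni 1 == i)%:R * slope y.
Proof.
move=> Vy yn; have [dc dcE] := is_derive_coordB i (ni 1) y (y0 (ni 1) 0).
have dp := smooth_derivable (v := evec i) smooth_slope Vy.
by rewrite [LHS](deriveM dc dp) dcE yn subrr scale0r add0r [LHS]mulrC.
Qed.

Lemma nijenhuis_variation s y : V y -> y (ni 1) 0 = y0 (ni 1) 0 ->
  nijenhuis (gauge bump_fn A s) y = nijenhuis A y + s * target y.
Proof.
move=> Vy yn; rewrite (@nijenhuis_gauge _ V _ _ _ _ (slope y)) //.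
- rewrite /slope mulNr mulrN opprK divfK// mulf_neq0 ?At ?An//.
- exact: smooth_bump_fn.
- by rewrite /bump_fn yn subrr mul0r.
- by rewrite derive_bump_fn// mul0r.
- by rewrite derive_bump_fn// eqxx mul1r.
Qed.

(** The change of the tensor is known only on the hyperplane where the linear factor vanishes. It
    contains the line through y0 in direction [ti 0], and [nij_jets] differentiates the tensor along
    that line only. *)
Lemma nij_jets_variation s :
  nij_jets (jet m (gauge bump_fn A s) y0) = nij_jets (jet m A y0) + s *: v.
Proof.
apply/matrixP => k j; rewrite ord1 !mxE.
have sG := smooth_gauge s oV smooth_bump_fn sA.
rewrite (nij_jetE oV Vy0 sG (ltn_ord k)) (nij_jetE oV Vy0 sA (ltn_ord k)).
have sN := smooth_nijenhuis oV sA.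
rewrite -(iter_derive_target k) -[X in _ = _ + X](iter_deriveZ s _ _ oV smooth_target Vy0).
rewrite -(iter_deriveD _ _ oV sN (smoothZ s oV smooth_target) Vy0).
have := @iter_derive_line _ _ _ (nijenhuis (gauge bump_fn A s))
  (fun y => nijenhuis A y + s *: target y) (evec (ti 0)) y0 k.
have lineV : \forall t \near (0 : R), nijenhuis (gauge bump_fn A s) (y0 + t *: evec (ti 0)) =
    nijenhuis A (y0 + t *: evec (ti 0)) + s *: target (y0 + t *: evec (ti 0)).
  move: (near_tangent_line 0 oV Vy0); apply: filterS => t Vt.
  apply: nijenhuis_variation => //.
  have := congr1 (fun C : 'cV[R]_2 => C 1 0) (dsubmx_tangent_line y0 t 0).
  by rewrite !mxE.
move=> /(_ lineV) /nbhs_singleton; rewrite scale0r addr0; exact.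
Qed.

(** Taking jets is linear, so s stays polynomial and the velocity in s is found without exchanging
    it with the derivatives in y. *)
Lemma jet_gauge s : jet m (gauge bump_fn A s) y0 =
  jet m A y0 + s *: jet m (gauge1 bump_fn A) y0 + (s * s) *: jet m (gauge2 bump_fn A) y0.
Proof.
have sG1 := smooth_gauge1 oV smooth_bump_fn sA.
have sG2 := smooth_gauge2 oV smooth_bump_fn sA.
rewrite (jet_lin m (s * s) oV (smoothD oV sA (smoothZ s oV sG1)) sG2 Vy0).
by rewrite (jet_lin m s oV sA sG1 Vy0).
Qed.

End Variation.

Lemma is_diff_quadratic_curve (E : normedModType R) (j w w' : E) :
  is_diff (0 : R) (fun s : R => j + s *: w + (s * s) *: w') ( *:%R^~ w).
Proof.
have sq : is_diff (0 : R) (id * id : R -> R) 0.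
  have := is_diffM (is_diff_id (0 : R)) (is_diff_id (0 : R)).
  by rewrite !scale0r addr0.
have := is_diffD (is_diffD (is_diff_cst j (0 : R)) (is_diff_scalel 0 w))
  (is_diff_comp sq (is_diff_scalel _ w')).
rewrite add0r (_ : _ \o 0 = 0) ?addr0//.
by apply/funext => s /=; rewrite scale0r.
Qed.

Lemma codim_nij_jets (M : manifold4 R) (L : set M) (phi : chart R M) x m :
  slice_chart L phi x ->
  codim_submanifold (structure_jets L phi x m)
    [set j | structure_jets L phi x m j /\ nij_jets j = 0] m.
Proof.
move=> [_ domx Lx Lphi]; split=> [j []//|j [Xj jz]].
exists setT, (@nij_jets R m); split => //.
- exact: openT.
- exact: smooth_nij_jets.
move=> v; have [A [V [[oV Vx Vphi] sA AA AL jE]]] := Xj.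
set y0 := phi x in Vx jE.
have L0 : L (par phi y0) by rewrite crdK.
have [At0 An0] := preserved_neq0 (AA _ Vx) (AL _ Vx L0).
have sAt := smooth_coord (ti 1) (ti 0) oV sA.
have sAn := smooth_coord (ni 0) (ni 1) oV sA.
(* [slope] divides by two entries that are nonzero at y0, hence on a smaller neighbourhood. *)
pose V1 := V `&` [set y | A y (ti 1) (ti 0) != 0].
have oV1 : open V1 by exact: open_neq0.
have V1V : V1 `<=` V by move=> y [].
pose V2 := V1 `&` [set y | A y (ni 0) (ni 1) != 0].
have oV2 : open V2 by apply: open_neq0 => // k; exact: Ck_sub (sAn k).
have V2V : V2 `<=` V by move=> y [/V1V].
have V2y0 : V2 y0 by split.
have At y : V2 y -> A y (ti 1) (ti 0) != 0 by move=> [[]].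
have An y : V2 y -> A y (ni 0) (ni 1) != 0 by move=> [].
have sA2 : smooth_on V2 A by move=> k; exact: Ck_sub (sA k).
pose b := bump_fn A y0 v.
have jG s := jet_gauge v oV2 V2y0 sA2 At An s.
have nG s := nij_jets_variation v oV2 V2y0 sA2 At An s.
pose w := jet m (gauge1 b A) y0.
pose c s := jet m (gauge b A s) y0.
have [dc dcE] : is_diff (0 : R) c ( *:%R^~ w).
  rewrite (_ : c = fun s => jet m A y0 + s *: w + (s * s) *: jet m (gauge2 b A) y0).
    exact: is_diff_quadratic_curve.
  by apply/funext => s; exact: jG.
have c0 : c 0 = j by rewrite /c jG !scale0r mul0r scale0r !addr0.
exists w.
  exists c; split => //; last first.
    by apply: DeriveDef; [exact: diff_derivable|rewrite deriveE// dcE /= scale1r].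
  apply: (@filterE _ (nbhs (0 : R))) => s; exists (gauge b A s), V2; split => //.
  - by split => // y /V2V /Vphi.
  - by apply: smooth_gauge => //; exact: smooth_bump_fn.
  - by move=> y /V2V Vy; apply: gauge_sq; exact: AA.
  (* In a slice chart the transverse coordinates are constant on L, so b vanishes there and the
     structure is unchanged. *)
  - move=> y V2y Ly; have Vy := V2V _ V2y.
    have [q domq qy] := Vphi _ Vy.
    have yn : dsubmx y = dsubmx y0.
      by rewrite -qy; apply/(Lphi q domq); rewrite -[q](crdK domq) qy.
    have b0 : b y = 0.
      rewrite /b /bump_fn; move/(congr1 (fun C : 'cV[R]_2 => C 1 0)): yn.
      by rewrite !mxE => ->; rewrite subrr mul0r.
    have -> : gauge b A s y = A y.
      by rewrite /gauge /gauge1 /gauge2 b0 mul0r oppr0 !scale0r !scaler0 !addr0.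
    exact: AL.
have dN : differentiable (@nij_jets R m) (c 0).
  exact: smooth_differentiable (@smooth_nij_jets R m) _.
have [_ E1] := is_diff_comp (differentiableP dc) (differentiableP dN).
(* Along the curve the equations take the values [s *: v], again a quadratic curve. Comparing its
   differential with the chain rule shows that w is sent to v. *)
have Ec : @nij_jets R m \o c = (fun s : R => 0 + s *: v + (s * s) *: 0).
  by apply/funext => s /=; rewrite /c nG -jE jz scaler0 addr0.
have [_ E2] := is_diff_quadratic_curve (0 : 'cV[R]_m) v 0.
have := congr1 (fun h : R -> 'cV[R]_m => h 1) E1.
by rewrite Ec E2 /= dcE c0 !scale1r.
Qed.

End Codimension.

(** * Structures with a holomorphic projection *)

Section Projection.
Context {R : realType}.
Notation idx := 'I_(2 + 2).

Definition derive_entries (E : normedModType R) m n (M : E -> 'M[R]_(m, n)) v y : 'M[R]_(m, n) :=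
  \matrix_(i, j) 'D_v (fun z => M z i j) y.

Lemma derive_mulmx (E : normedModType R) m n p (M : E -> 'M[R]_(m, n))
    (N : E -> 'M[R]_(n, p)) v y :
  (forall i j, derivable (fun z => M z i j) y v) ->
  (forall i j, derivable (fun z => N z i j) y v) ->
  derive_entries (fun z => M z *m N z) v y =
  derive_entries M v y *m N y + M y *m derive_entries N v y.
Proof.
move=> dM dN; apply/matrixP => i j; rewrite !mxE.
have -> : (fun z => (M z *m N z) i j) = \sum_k (fun z => M z i k) * (fun z => N z k j).
  by apply/funext => z; rewrite mxE fct_sumE.
rewrite derive_sum => [|k]; last exact: derivableM.
rewrite -big_split /=; apply: eq_bigr => k _.
rewrite deriveM// !mxE addrC; congr (_ + _); exact: mulrC.
Qed.

Lemma derive_entries_eq (E : normedModType R) (U : set E) m n (M N : E -> 'M[R]_(m, n)) v y :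
  open U -> (forall z, U z -> M z = N z) -> U y ->
  derive_entries M v y = derive_entries N v y.
Proof.
move=> oU MN Uy; apply/matrixP => i j; rewrite !mxE.
by apply: derive_eq_on Uy => // z /MN->.
Qed.

Lemma derive_along_slice (U : set 'cV[R]_(2 + 2)) (h : 'cV[R]_(2 + 2) -> R) y k :
  open U -> U y -> (forall z, U z -> dsubmx z = dsubmx y -> h z = h y) ->
  'D_(evec (ti k)) h y = 0.
Proof.
move=> oU Uy hc; rewrite -[y in LHS]addr0 -(scale0r (evec (ti k))) derive_line.
transitivity ('D_1 (cst (h y) : R -> R) 0); last exact: derive_cst.
apply: near_eq_derive.
move: (near_tangent_line k oU Uy); apply: filterS => t Ut.
by apply: hc => //; exact: dsubmx_tangent_line.
Qed.

(** The eight terms form one entry of an expression in 2 x 2 blocks, so the vanishing can be proved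
    by matrix algebra. *)
Lemma nijenhuis_mx (A : 'cV[R]_(2 + 2) -> 'M[R]_(2 + 2)) y :
  let e := drsubmx (A y) in
  let De k := drsubmx (derive_entries A (evec (ti k)) y) in
  let Q := \matrix_(k, j) 'D_(evec (ni j)) (fun z => A z (ni k) (ti 0)) y : 'M[R]_2 in
  nijenhuis A y = (e *m Q - Q *m e - e *m De 0 +
    (A y (ti 0) (ti 0) *: De 0 + A y (ti 1) (ti 0) *: De 1)) 0 1.
Proof.
move=> e De Q.
(* Naming each entry by a variable leaves [ring] a polynomial identity. *)
have expand (B P D0 D1 : 'M[R]_2) a b b00 b01 b11 p00 p01 p11 c0 c1 d0 d1 :
    B 0 0 = b00 -> B 0 1 = b01 -> B 1 1 = b11 ->
    P 0 0 = p00 -> P 0 1 = p01 -> P 1 1 = p11 ->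
    D0 0 1 = c0 -> D0 1 1 = c1 -> D1 0 1 = d1 -> D0 0 1 = d0 ->
    (b00 * p01 - b01 * p00 - b00 * c0 + a * d0) +
    (b01 * p11 - b11 * p01 - b01 * c1 + b * d1) =
    (B *m P - P *m B - B *m D0 + (a *: D0 + b *: D1)) 0 1.
  by do 9!move=> <-; move=> <-; rewrite !mxE !sum_I2; ring.
rewrite /nijenhuis nij_sumE sum_I2.
by apply: expand; rewrite ?mxE.
Qed.

(** Here g stands for the transverse part of dW, G0 and G1 for its tangential derivatives, D0 and D1
    for those of e. After substitution everything containing G0 and G1, the second derivatives of W,
    cancels. *)
Lemma transverse_nijenhuis n (g J e Q G0 G1 D0 D1 : 'M[R]_n) a b :
  g *m e = J *m g -> G0 *m e + g *m D0 = J *m G0 -> G1 *m e + g *m D1 = J *m G1 ->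
  g *m Q = J *m G0 - (a *: G0 + b *: G1) ->
  g *m (e *m Q - Q *m e - e *m D0 + (a *: D0 + b *: D1)) = 0.
Proof.
move=> ge E0 E1 gQ.
have gD0 : g *m D0 = J *m G0 - G0 *m e by rewrite -E0 addrC addKr.
have gD1 : g *m D1 = J *m G1 - G1 *m e by rewrite -E1 addrC addKr.
rewrite mulmxDr !mulmxBr mulmxDr -!scalemxAr !mulmxA ge gQ -!mulmxA gQ gD0 gD1.
rewrite !mulmxBr !mulmxBl mulmxDr mulmxDl -!scalemxAr -!scalemxAl !mulmxA.
move: (J *m J *m _) (J *m G0 *m e) (J *m G0) (J *m G1) (G0 *m e) (G1 *m e).
by move=> B1 B2 B3 B4 B5 B6; apply/matrixP => i j; rewrite !mxE; ring.
Qed.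

(** Tangential and transverse derivatives of dW o A = J o dW give the hypotheses of
    [transverse_nijenhuis]. Its factor g is invertible because the kernel of dW is no larger than
    the tangent plane. *)
Lemma nijenhuis_projection (U : set 'cV[R]_(2 + 2)) (A : 'cV[R]_(2 + 2) -> 'M[R]_(2 + 2))
    (W : 'cV[R]_(2 + 2) -> 'cV[R]_2) (J : 'cV[R]_(2 + 2) -> 'M[R]_2) y :
  open U -> U y -> smooth_on U A -> smooth_on U W ->
  (forall i j, differentiable (fun z => J z i j) y) ->
  (forall z, U z -> forall v, 'd W z (A z *m v) = J z *m 'd W z v) ->
  (forall z, U z -> dsubmx z = dsubmx y -> forall v, dsubmx v = 0 -> 'd W z v = 0) ->
  (forall v, 'd W y v = 0 -> dsubmx v = 0) ->
  (forall z, U z -> dsubmx z = dsubmx y -> J z = J y) ->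
  nijenhuis A y = 0.
Proof.
move=> oU Uy sA sW dJ WA Wt Wn Jc.
(* The existential keeps [G] opaque under rewriting. *)
have [G GW] : exists G, forall z, G z = jac W z by exists (jac W).
have GWE z v : 'd W z v = G z *m v by rewrite GW jacE.
have GE r k z : U z -> G z r k = 'D_(evec k) (fun z => W z r 0) z.
  move=> Uz; have dW := smooth_differentiable sW Uz.
  have [de deE] := diff_entry r 0 dW.
  by rewrite deriveE// deE GW mxE.
have sWr r : smooth_on U (fun z => W z r 0) by exact: smooth_coord.
have sG r k : smooth_on U (fun z => G z r k).
  move=> n; apply: (Ck_eq (f := 'D_(evec k) (fun z => W z r 0)) oU).
    by move=> z Uz; rewrite GE.
  by apply: smooth_derive.
have Gt z r k : U z -> dsubmx z = dsubmx y -> G z r (ti k) = 0.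
  by move=> Uz zy; rewrite GW mxE Wt// ?mxE// dsubmx_evec_ti.
have GA z : U z -> G z *m A z = J z *m G z.
  move=> Uz; apply/matrixP => r k.
  have := WA z Uz (evec k); rewrite !GWE !mulmxA.
  move=> /(congr1 (fun C : 'cV[R]_2 => C r 0)).
  by rewrite !mulmx_delta_entry eqxx !mulr1.
have dG v i j : derivable (fun z => G z i j) y v.
  exact: smooth_derivable (sG i j) Uy.
have dA v i j : derivable (fun z => A z i j) y v.
  exact: smooth_derivable (smooth_coord i j oU sA) Uy.
have DGA v : derive_entries G v y *m A y + G y *m derive_entries A v y =
             derive_entries J v y *m G y + J y *m derive_entries G v y.
  rewrite -!derive_mulmx//; first exact: derive_entries_eq oU GA Uy.
  by move=> i j; exact: diff_derivable.
(* By symmetry of second derivatives, the transverse derivative of a tangential column of [G] is the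
   tangential derivative of a transverse one. *)
have swap r k l : derive_entries G (evec k) y r l = derive_entries G (evec l) y r k.
  have aux a b : derive_entries G (evec a) y r b =
      'd (fun z => 'd (fun z => W z r 0) z (evec b)) y (evec a).
    rewrite mxE -deriveE; last by have [_ /(_ (evec b))[]] := sWr r 2%N; auto.
    apply: derive_eq_on Uy => // z Uz; rewrite GE// deriveE//.
    exact: smooth_differentiable (sWr r) Uz.
  apply: etrans (aux k l) (etrans _ (esym (aux l k))).
  exact: schwarz (evec l) (evec k) oU (sWr r 2%N) Uy.
pose g := rsubmx (G y).
have GyE : G y = row_mx 0 g.
  rewrite -[LHS]hsubmxK; congr row_mx.
  by apply/matrixP => i j; rewrite !mxE; exact: Gt.
have g_unit : g \in unitmx.
  apply: unitmx_inj => v gv.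
  have := Wn (col_mx 0 v); rewrite GWE GyE mul_row_col mul0mx add0r gv.
  by rewrite col_mxKd; exact.
have A0 r k : A y (ni r) (ti k) = 0.
  apply: preserved_entry => v v0; apply: Wn.
  by rewrite WA// Wt// mulmx0.
pose Dg k := rsubmx (derive_entries G (evec (ti k)) y).
have DGE k : derive_entries G (evec (ti k)) y = row_mx 0 (Dg k).
  rewrite -[LHS]hsubmxK; congr row_mx.
  apply/matrixP => i j; rewrite 2!mxE [RHS]mxE.
  apply: (@derive_along_slice U (fun z => G z i (ti j)) y k oU Uy) => z Uz zy.
  exact: etrans (Gt z i j Uz zy) (esym (Gt y i j Uy erefl)).
have DJ k : derive_entries J (evec (ti k)) y = 0.
  apply/matrixP => i j; rewrite 2!mxE.
  by apply: (@derive_along_slice U (fun z => J z i j) y k oU Uy) => z Uz /Jc->.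
pose e := drsubmx (A y).
pose De k := drsubmx (derive_entries A (evec (ti k)) y).
pose Q := \matrix_(k, j) 'D_(evec (ni j)) (fun z => A z (ni k) (ti 0)) y : 'M[R]_2.
have row0 (h : 'M[R]_2) (B : 'M[R]_(2 + 2)) : rsubmx (row_mx 0 h *m B) = h *m drsubmx B.
  by rewrite -{1}[B]submxK mul_row_block !mul0mx !add0r row_mxKr.
have rsubM (h : 'M[R]_2) (B : 'M[R]_(2, 2 + 2)) : rsubmx (h *m B) = h *m rsubmx B.
  by rewrite -{1}[B]hsubmxK mul_mx_row row_mxKr.
have ge : g *m e = J y *m g.
  by have := congr1 rsubmx (GA y Uy); rewrite rsubM GyE row0 row_mxKr.
have Dge k : Dg k *m e + g *m De k = J y *m Dg k.
  have := congr1 rsubmx (DGA (evec (ti k))).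
  rewrite DJ mul0mx add0r rsubM DGE row_mxKr GyE => <-.
  by rewrite linearD /= !row0.
have gQ : g *m Q = J y *m Dg 0 - (A y (ti 0) (ti 0) *: Dg 0 + A y (ti 1) (ti 0) *: Dg 1).
  apply/matrixP => r j.
  have DGn q l : derive_entries G (evec (ni j)) y q (ti l) = Dg l q j.
    by rewrite [RHS]mxE; exact: swap.
  have DAn k : derive_entries A (evec (ni j)) y (ni k) (ti 0) = Q k j.
    by rewrite [LHS]mxE [RHS]mxE.
  have Gn q k : G y q (ni k) = g q k by rewrite [RHS]mxE.
  have G0 q k : G y q (ti k) = 0 by exact: Gt.
  have := congr1 (fun C : 'M[R]_(2, 2 + 2) => C r (ti 0)) (DGA (evec (ni j))).
  move: (derive_entries G _ y) (derive_entries A _ y) (derive_entries J _ y) DGn DAn.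
  move=> B C D BE CE.
  rewrite [X in X = _ -> _]mxE [X in _ = X -> _]mxE.
  rewrite [X in X + _ = _ -> _]mxE [X in _ + X = _ -> _]mxE.
  rewrite [X in _ = X + _ -> _]mxE [X in _ = _ + X -> _]mxE.
  (* The transverse derivative of J is not controlled, but it multiplies a tangential column of [G],
     which is zero. *)
  rewrite !big_split_ord /= !sum_I2 !A0 !G0 !BE !CE !Gn.
  move: (Dg) (g) (Q) (J y) (A y) => D' g' Q' J' A'; rewrite !mxE !sum_I2; lra.
have gN := transverse_nijenhuis ge (Dge 0) (Dge 1) gQ.
have g_inj (N : 'M[R]_2) : g *m N = 0 -> N = 0.
  by move=> gN0; rewrite -(mulKmx g_unit N) gN0 mulmx0.
by rewrite nijenhuis_mx (g_inj _ gN) mxE.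
Qed.

End Projection.

(** * Charts and leaves *)

Section Charts.
Context {R : realType} {M : manifold4 R}.
Implicit Types (phi psi eta : chart R M) (p q : M).

Lemma open_chart_image phi (A : set M) : open A -> open (phi @` (dom phi `&` A)).
Proof.
move=> oA; rewrite openE => _ [p [domp Ap] <-].
have imp : (phi @` dom phi) (phi p) by exists p.
have oI := @img_open _ _ phi.
have : \forall y \near phi p, (phi @` dom phi) y /\ A (par phi y).
  apply: filterI; first exact: open_nbhs_nbhs.
  have : nbhs (par phi (phi p)) A by rewrite crdK//; exact: open_nbhs_nbhs.
  exact: (par_continuous imp).
apply: filterS => y [[q domq <-]]; rewrite crdK// => Aq.
by exists q.
Qed.

Lemma transition_crd phi psi p : dom phi p -> transition phi psi (phi p) = psi p.
Proof. by move=> domp; rewrite /transition crdK. Qed.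

Lemma smooth_transition phi psi : charts phi -> charts psi ->
  smooth_on (phi @` (dom phi `&` dom psi)) (transition phi psi).
Proof. exact: charts_compatible. Qed.

Lemma open_transition phi psi : open (phi @` (dom phi `&` dom psi)).
Proof. by apply: open_chart_image; exact: dom_open. Qed.

Lemma differentiable_transition phi psi p : charts phi -> charts psi ->
  dom phi p -> dom psi p -> differentiable (transition phi psi) (phi p).
Proof.
move=> cphi cpsi dphi dpsi.
by apply: smooth_differentiable (smooth_transition cphi cpsi) _; exists p.
Qed.

Lemma diff_transition_comp phi psi eta p v :
  charts phi -> charts psi -> charts eta ->
  dom phi p -> dom psi p -> dom eta p ->
  'd (transition psi eta) (psi p) ('d (transition phi psi) (phi p) v) =
  'd (transition phi eta) (phi p) v.
Proof.
move=> cphi cpsi ceta dphi dpsi deta.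
have d1 := differentiableP (differentiable_transition cphi cpsi dphi dpsi).
have d2 := differentiable_transition cpsi ceta dpsi deta.
rewrite -(transition_crd psi dphi) in d2 *.
have d12 := is_diff_comp d1 (differentiableP d2).
have pU : (phi @` (dom phi `&` dom psi)) (phi p) by exists p.
have fg : {near phi p, transition psi eta \o transition phi psi =1 transition phi eta}.
  have eqU y : (phi @` (dom phi `&` dom psi)) y ->
      (transition psi eta \o transition phi psi) y = transition phi eta y.
    by move=> [q [q1 q2] <-] /=; rewrite !transition_crd.
  exact: (near_open_eq (@open_transition phi psi) pU eqU).
have [_ dE] := is_diff_near fg d12.
exact: esym (congr1 (@^~ v) dE).
Qed.

Lemma diff_transition_id phi p v : charts phi -> dom phi p ->
  'd (transition phi phi) (phi p) v = v.
Proof.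
move=> cphi dphi.
have pU : (phi @` (dom phi `&` dom phi)) (phi p) by exists p.
have fg : {near phi p, id =1 transition phi phi}.
  have eqU y : (phi @` (dom phi `&` dom phi)) y -> id y = transition phi phi y.
    by move=> [q [q1 q2] <-] /=; rewrite transition_crd.
  exact: (near_open_eq (@open_transition phi phi) pU eqU).
have [_ dE] := is_diff_near fg (is_diff_id (phi p)).
exact: (congr1 (@^~ v) dE).
Qed.

Lemma diff_transitionK phi psi p v : charts phi -> charts psi ->
  dom phi p -> dom psi p ->
  'd (transition psi phi) (psi p) ('d (transition phi psi) (phi p) v) = v.
Proof.
by move=> *; rewrite diff_transition_comp// diff_transition_id.
Qed.

Lemma diff_dsub_transition phi psi p : charts phi -> charts psi ->
  dom phi p -> dom psi p ->
  is_diff (phi p) (fun y => dsubmx (transition phi psi y))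
          (fun v => dsubmx ('d (transition phi psi) (phi p) v)).
Proof.
move=> cphi cpsi dphi dpsi.
exact: (diff_mxlin (dsubmx : {linear 'cV[R]_(2 + 2) -> 'cV[R]_2})
  (differentiable_transition cphi cpsi dphi dpsi)).
Qed.

End Charts.

(** * Leafwise paths and their concatenation *)

Section Leaves.
Context {R : realType} {M : manifold4 R}.
Implicit Types (phi psi eta : chart R M) (p q : M) (F : set (chart R M)).

Lemma within_continuous_comp (T U V : topologicalType) (A : set T) (B : set U)
    (g : T -> U) (f : U -> V) :
  (forall t, A t -> B (g t)) -> (forall t, A t -> {for t, continuous g}) ->
  {within B, continuous f} -> {within A, continuous (f \o g)}.
Proof.
move=> AB cg /subspace_continuousP cf; apply/subspace_continuousP => t At P Pt.
have ct : nbhs t [set s | B (g s) -> P (f (g s))] := cg t At _ (cf _ (AB t At) P Pt).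
change (nbhs t [set s | A s -> P (f (g s))]).
by move: ct; apply: filterS => s BP As; exact: BP (AB s As).
Qed.

Lemma leafwise_chart F phi (c : R -> M) : F phi -> {within `[0, 1], continuous c} ->
  (forall t, 0 <= t <= 1 -> dom phi (c t) /\ dsubmx (phi (c t)) = dsubmx (phi (c 0))) ->
  leafwise F c.
Proof.
move=> Fphi cc cphi; split=> // t t01; exists phi; have [dt et] := cphi t t01.
split=> //; apply: (@filterE _ (nbhs t)) => s s01.
by have [_ ->] := cphi s s01.
Qed.

Lemma leaf_chart F phi (c : R -> M) : F phi -> {within `[0, 1], continuous c} ->
  (forall t, 0 <= t <= 1 -> dom phi (c t) /\ dsubmx (phi (c t)) = dsubmx (phi (c 0))) ->
  leaf F (c 0) (c 1).
Proof. by move=> Fphi cc cphi; exists c; split => //; exact: leafwise_chart cphi. Qed.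

Lemma leaf_trans F p q r : foliation F -> leaf F p q -> leaf F q r -> leaf F p r.
Proof.
move=> [_ Fcompat] [c1 [[cc1 lc1] c10 c11]] [c2 [[cc2 lc2] c20 c21]].
pose c t : M := if t <= 2^-1 then c1 (2 * t) else c2 (2 * t - 1).
have cL t : t <= 2^-1 -> c t = c1 (2 * t) by rewrite /c => ->.
have cR t : 2^-1 <= t -> c t = c2 (2 * t - 1).
  rewrite le_eqVlt => /predU1P[<-|tlt]; last by rewrite /c leNgt tlt.
  by rewrite /c lexx mulfV// subrr c11 c20.
have cont_affine (a b : R) : continuous (fun t : R => a * t + b).
  move=> t; apply: continuousD; last exact: cst_continuous.
  by apply: continuousM; [exact: cst_continuous|exact: cvg_id].
have near_affine (a b t : R) (P : R -> Prop) :
    (\forall s \near a * t + b, P s) -> \forall s \near t, P (a * s + b).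
  by move=> nP; exact: (cont_affine a b t _ nP).
exists c; split; last 2 first.
- by rewrite cL ?invr_ge0// mulr0.
- by rewrite cR ?invf_le1 ?ler1n// mulr1 (_ : 2 - 1 = 1)//; ring.
split.
  rewrite (_ : `[0, 1]%classic = `[0, 2^-1] `|` `[2^-1, 1]); last first.
    apply/seteqP; split => t /=; rewrite !in_itv /=.
      by move=> /andP[t0 t1]; case: (leP t 2^-1) => th; [left|right]; apply/andP; split => //; exact: ltW.
    by case=> /andP[t0 t1]; apply/andP; split; lra.
  apply: withinU_continuous; [exact: itv_closed|exact: itv_closed| |].
    apply: (@subspace_eq_continuous _ _ _ (c1 \o (fun t => 2 * t + 0))).
      by move=> t; rewrite inE /= in_itv /= => /andP[_ th]; rewrite -[RHS]/(c t) cL// addr0.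
    apply: within_continuous_comp cc1 => [t|t _]; last exact: cont_affine.
    by rewrite /= !in_itv /= => /andP[t0 t1]; apply/andP; split; lra.
  apply: (@subspace_eq_continuous _ _ _ (c2 \o (fun t => 2 * t + - 1))).
    by move=> t; rewrite inE /= in_itv /= => /andP[th _]; rewrite -[RHS]/(c t) cR.
  apply: within_continuous_comp cc2 => [t|t _]; last exact: cont_affine.
  by rewrite /= !in_itv /= => /andP[t0 t1]; apply/andP; split; lra.
move=> t /andP[t0 t1]; case: (ltgtP t 2^-1) => th.
- have t01 : 0 <= 2 * t <= 1 by apply/andP; split; lra.
  have [phi [Fphi dphi near1]] := lc1 _ t01; exists phi.
  rewrite (cL _ (ltW th)); split=> //.
  rewrite -[2 * t]addr0 in near1.
  have n2 : \forall s \near t, s < 2^-1 by exact: lt_nbhsl.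
  move: (near_affine _ _ _ _ near1) n2; apply: filterS2 => s + sh /andP[s0 s1].
  by rewrite (cL _ (ltW sh)) !addr0; apply; apply/andP; split; lra.
- have t01 : 0 <= 2 * t - 1 <= 1 by apply/andP; split; lra.
  have [phi [Fphi dphi near1]] := lc2 _ t01; exists phi.
  rewrite (cR _ (ltW th)); split=> //.
  have n1 := near_affine _ _ _ _ near1.
  have n2 : \forall s \near t, 2^-1 < s by exact: lt_nbhsr.
  move: n1 n2; apply: filterS2 => s E1 sh /andP[s0 s1].
  by rewrite (cR _ (ltW sh)) E1//; apply/andP; split; lra.
(* At the junction the chart of the second path is used. The first path is constant in the
   transverse coordinate of its own chart, and compatibility of the two charts near q transfers
   this. *)
- have one01 : 0 <= (1 : R) <= 1 by rewrite ler01 lexx.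
  have zero01 : 0 <= (0 : R) <= 1 by rewrite ler01 lexx.
  have [phi1 [F1 d1 n1]] := lc1 _ one01; have [phi2 [F2 d2 n2]] := lc2 _ zero01.
  rewrite c11 in d1 n1; rewrite c20 in d2 n2.
  have ct : c t = q by rewrite th cL// mulfV.
  exists phi2; rewrite ct; split=> //.
  have [V Vq VP] := Fcompat _ _ _ F1 F2 d1 d2.
  have nV : \forall s \near (1 : R), 0 <= s <= 1 -> V (c1 s).
    have /subspace_continuousP/(_ 1) cc := cc1.
    have one_in : `[(0 : R), 1]%classic 1 by rewrite /= in_itv.
    have Vq' : nbhs (c1 1) V by rewrite c11.
    have : nbhs (1 : R) [set s | `[0, 1]%classic s -> V (c1 s)] := cc one_in _ Vq'.
    by apply: filterS => s VP' s01; apply: VP'; rewrite /= in_itv.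
  have t2 : 2 * t + 0 = 1 by rewrite th addr0 mulfV.
  have t3 : 2 * t + -1 = 0 by rewrite th mulfV// subrr.
  have near_l P : (\forall s \near (1 : R), P s) -> \forall s \near t, P (2 * s).
    move=> nP; have nP' : \forall s \near 2 * t + 0, P s by rewrite t2.
    by move: (near_affine _ _ _ _ nP'); apply: filterS => s; rewrite addr0.
  have near_r P : (\forall s \near (0 : R), P s) -> \forall s \near t, P (2 * s - 1).
    move=> nP; have nP' : \forall s \near 2 * t + -1, P s by rewrite t3.
    exact: near_affine nP'.
  move: (near_l _ n1) (near_l _ nV) (near_r _ n2).
  apply: filterS3 => s E1 VV E2 /andP[s0 s1].
  case: (leP s 2^-1) => sh.
    have s01 : 0 <= 2 * s <= 1 by apply/andP; split; lra.
    rewrite cL//; apply: VP; [exact: VV|exact: nbhs_singleton|].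
    by rewrite E1.
  have s01 : 0 <= 2 * s - 1 <= 1 by apply/andP; split; lra.
  by rewrite cR ?(ltW sh)// E2.
Qed.

End Leaves.

(** * Tangent planes of leaves *)

Section LeafTangency.
Context {R : realType} {M : manifold4 R}.
Implicit Types (phi psi eta gam : chart R M) (p q x : M) (F : set (chart R M)).

Lemma within_par_continuous phi (A : set R) (l : R -> 'cV[R]_(2 + 2)) :
  (forall s, A s -> (phi @` dom phi) (l s) /\ {for s, continuous l}) ->
  {within A, continuous (fun s => par phi (l s))}.
Proof.
move=> lA; apply: continuous_in_subspaceT => s; rewrite inE => /lA[ls cl].
by apply: continuous_comp => //; exact: par_continuous.
Qed.

(** A short segment in a plaque of [gam] stays in the leaf, where the transverse coordinate of the
    slice chart [psi] is constant. *)
Lemma leaf_tangent F gam psi x p p' v :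
  foliation F -> F gam -> slice_chart (leaf F x) psi p' -> leaf F x p ->
  dom gam p -> dom psi p -> dsubmx v = 0 ->
  dsubmx ('d (transition gam psi) (gam p) v) = 0.
Proof.
move=> fF Fg [cpsi _ Sp' slice] Sp dgam dpsi v0.
have cgam : charts gam by case: fF => + _; exact.
have [df dfE] := diff_dsub_transition cgam cpsi dgam dpsi.
have pU : (gam @` (dom gam `&` dom psi)) (gam p) by exists p.
have [r r0 rU] := open_normP (@open_transition R M gam psi) pU.
have r1 : 0 < r / (1 + `|v|) by rewrite divr_gt0// ltr_pwDl.
pose f y := dsubmx (transition gam psi y).
have const : \forall t \near (0 : R), dsubmx (psi p') = f (gam p + t *: v).
  apply/nbhs_ballP; exists (r / (1 + `|v|)) => // t.
  rewrite -ball_normE /= sub0r normrN ltr_pdivlMr ?ltr_pwDl// => tr.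
  have inU s : 0 <= s <= 1 -> (gam @` (dom gam `&` dom psi)) (gam p + s *: (t *: v)).
    move=> /andP[s0 s1]; apply: rU; rewrite addrAC subrr add0r.
    apply: le_lt_trans tr; rewrite !normrZ ger0_norm//.
    rewrite mulrDr mulr1 (le_trans (ler_piMl _ s1))// ?mulr_ge0// ler_wpDl//.
  pose c s := par gam (gam p + s *: (t *: v)).
  have c0 : c 0 = p by rewrite /c scale0r addr0 crdK.
  have cdom s : 0 <= s <= 1 -> dom gam (c s) /\ dom psi (c s).
    by move=> /inU[q [q1 q2] cs]; rewrite /c -cs crdK.
  have cE s : 0 <= s <= 1 -> gam (c s) = gam p + s *: (t *: v).
    by move=> /inU[q [q1 _] cs]; rewrite /c -cs crdK.
  have one01 : 0 <= (1 : R) <= 1 by rewrite ler01 lexx.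
  have lc : leaf F (c 0) (c 1).
    apply: (leaf_chart Fg) => [|s s01].
      apply: within_par_continuous => s; rewrite /= in_itv /= => s01.
      split; last exact: continuous_line.
      by have [q [q1 _] <-] := inU s s01; exists q.
    split; first by have [] := cdom s s01.
    by rewrite c0 cE// linearD /= !linearZ /= v0 !scaler0 addr0.
  rewrite c0 in lc.
  have Sc := leaf_trans fF Sp lc.
  have [_ dc] := cdom 1 one01.
  have /slice <- := Sc; last by [].
  by rewrite /f /transition /c scale1r.
have -> : dsubmx ('d (transition gam psi) (gam p) v) = 'd f (gam p + 0 *: v) v.
  by rewrite scale0r addr0 dfE.
have df0 : differentiable f (gam p + 0 *: v) by rewrite scale0r addr0.
have [_ <-] := is_derive_line df0.
by rewrite -(near_eq_derive _ const) derive_cst.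
Qed.

Lemma preserved_inverse (t t' : 'M[R]_(2 + 2)) : t' *m t = 1%:M ->
  (forall v : 'cV[R]_(2 + 2), dsubmx v = 0 -> dsubmx (t *m v) = 0) ->
  forall u : 'cV[R]_(2 + 2), dsubmx (t' *m u) = 0 <-> dsubmx u = 0.
Proof.
move=> t't tP u; have tt' := mulmx1C t't.
split=> [|u0]; first by move=> /tP; rewrite mulmxA tt' mul1mx.
have t0 : dlsubmx t = 0.
  by apply/matrixP => i j; have := preserved_entry tP i j; rewrite !mxE.
have := t't; rewrite -{1}[t]submxK -{1}[t']submxK t0 mulmx_block !mulmx0 !addr0.
rewrite (@scalar_mx_block _ 2 2) => /eq_block_mx[aa _ ca _].
have t'0 : dlsubmx t' = 0.
  by rewrite -[LHS]mulmx1 -(mulmx1C aa) mulmxA ca mul0mx.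
rewrite -[u]vsubmxK u0 -[t']submxK t'0 mul_block_col col_mxKd.
by rewrite mul0mx mulmx0 addr0.
Qed.

(** Plaque and leaf have the same dimension, so the inclusion of tangent planes in [leaf_tangent] is
    an equality; in matrices, the inverse of a block triangular matrix is block triangular. *)
Lemma leaf_kernel F gam psi x p p' u :
  foliation F -> F gam -> slice_chart (leaf F x) psi p' -> leaf F x p ->
  dom gam p -> dom psi p ->
  dsubmx ('d (transition psi gam) (psi p) u) = 0 <-> dsubmx u = 0.
Proof.
move=> fF Fg sl Sp dgam dpsi.
have cgam : charts gam by case: fF => + _; exact.
have cpsi : charts psi by case: sl.
rewrite jacE; apply: (@preserved_inverse (jac (transition gam psi) (gam p))).
  apply/matrixP => i j.
  have := diff_transitionK (delta_mx j 0) cgam cpsi dgam dpsi.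
  rewrite !jacE mulmxA => /(congr1 (fun C : 'cV[R]_(2 + 2) => C i 0)).
  rewrite mulmx_delta_entry eqxx mulr1 => ->.
  by rewrite !mxE andbT.
by move=> v v0; rewrite -jacE; exact: leaf_tangent sl Sp dgam dpsi v0.
Qed.

(** A leaf is only a union of plaques and might return near p through another one. This is excluded
    by the mean value theorem along segments of the slice, on which [leaf_kernel] makes the
    derivative vanish. *)
Lemma leaf_transverse_const F gam psi x p : foliation F -> F gam ->
  slice_chart (leaf F x) psi p -> dom gam p ->
  exists2 r : R, 0 < r & forall y, `|y - psi p| < r ->
    (psi @` (dom psi `&` dom gam)) y /\
    (dsubmx y = dsubmx (psi p) -> dsubmx (transition psi gam y) = dsubmx (gam p)).
Proof.
move=> fF Fg sl dgam; have [cpsi dpsi Sp slice] := sl.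
have cgam : charts gam by case: fF => + _; exact.
have pU : (psi @` (dom psi `&` dom gam)) (psi p) by exists p.
have [r r0 rU] := open_normP (@open_transition R M psi gam) pU.
exists r => // y yr; split=> [|y0]; first exact: rU.
pose v := y - psi p.
have v0 : dsubmx v = 0 by rewrite /v linearB /= y0 subrr.
have seg s : 0 <= s <= 1 -> exists q, [/\ dom psi q, dom gam q, leaf F x q &
    psi q = psi p + s *: v].
  move=> /andP[s0 s1].
  have [q [q1 q2] qE] : (psi @` (dom psi `&` dom gam)) (psi p + s *: v).
    apply: rU; rewrite addrAC subrr add0r; apply: le_lt_trans yr.
    by rewrite normrZ ger0_norm// ler_piMl.
  exists q; split => //; apply/(slice q q1).
  by rewrite qE linearD linearZ /= v0 scaler0 addr0.
have -> : y = psi p + v by rewrite /v addrC subrK.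
rewrite -(transition_crd gam dpsi).
apply/matrixP => i j; rewrite ord1; apply/eqP; rewrite -subr_eq0; apply/eqP.
pose f z := dsubmx (transition psi gam z) i 0.
have df s : 0 <= s <= 1 -> is_diff (psi p + s *: v) f
    (fun w => dsubmx ('d (transition psi gam) (psi p + s *: v) w) i 0).
  move=> /seg[q [q1 q2 Sq <-]].
  have [dd ddE] := diff_dsub_transition cpsi cgam q1 q2.
  have := diff_entry i 0 dd; by rewrite ddE.
have [s s01 E] : exists2 s : R, 0 <= s <= 1 & f (psi p + v) - f (psi p) = 'd f (psi p + s *: v) v.
  by apply: MVT_line => s /df[].
rewrite -[LHS]/(f (psi p + v) - f (psi p)) E.
have [_ ->] := df s s01.
have [q [q1 q2 Sq <-]] := seg s s01.
have /(leaf_kernel _ fF Fg sl Sq q2 q1) -> := v0.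
by rewrite mxE.
Qed.

(** A foliated chart is a slice chart for its own plaques, so J is block triangular in it; the lower
    right block is the matrix e with dw o J = e o dw. *)
Lemma PH_foliation_block (J : tensor_field M) F eta p (v : 'cV[R]_(2 + 2)) :
  PH_foliation J F -> F eta -> dom eta p ->
  dsubmx (J eta p *m v) = drsubmx (J eta p) *m dsubmx v.
Proof.
move=> [[Fc _] PH] Feta deta; have [_ /(_ eta p) pres] := PH eta p Feta deta.
have sl : slice_chart (plaque eta p) eta p.
  by split=> [|//||q dq]; [exact: Fc|split|split=> [[]//|E]; split].
have J0 : dlsubmx (J eta p) = 0.
  apply/matrixP => i j; rewrite [RHS]mxE.
  by have := preserved_entry (pres sl) i j; rewrite !mxE.
by rewrite -{1}[J eta p]submxK -{1}[v]vsubmxK mul_block_col col_mxKd J0 mul0mx add0r.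
Qed.

Lemma PH_foliation_transition (J : tensor_field M) F eta phi p (v : 'cV[R]_(2 + 2)) :
  almost_complex J -> PH_foliation J F -> F eta -> charts phi ->
  dom phi p -> dom eta p ->
  dsubmx ('d (transition phi eta) (phi p) (J phi p *m v)) =
  drsubmx (J eta p) *m dsubmx ('d (transition phi eta) (phi p) v).
Proof.
move=> [_ _ Jtr] PH Feta cphi dphi deta.
have ceta : charts eta by case: PH => [[+ _] _]; exact.
by rewrite (Jtr _ _ _ cphi ceta dphi deta) (PH_foliation_block _ PH).
Qed.

End LeafTangency.

(** * Product coordinates and transports *)

Section ColMx.
Context {R : realType}.

Lemma norm_col_mx_lt m n (a : 'cV[R]_m) (b : 'cV[R]_n) e :
  `|a| < e -> `|b| < e -> `|col_mx a b| < e.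
Proof.
move=> ae be; apply: (@le_lt_trans _ _ (Num.max `|a| `|b|)); last by rewrite gt_max ae.
apply: mx_norm_le => [|i j]; first by rewrite le_max normr_ge0.
rewrite le_max; case: (splitP i) => k ik.
  by rewrite (_ : i = lshift n k) ?col_mxEu ?mx_norm_entry//; exact: val_inj.
by rewrite (_ : i = rshift m k) ?col_mxEd ?mx_norm_entry ?orbT//; exact: val_inj.
Qed.

Lemma norm_col_mxu m n (a : 'cV[R]_m) (b : 'cV[R]_n) : `|a| <= `|col_mx a b|.
Proof.
by apply: mx_norm_le => // i j; rewrite -(col_mxEu a b); exact: mx_norm_entry.
Qed.

Lemma norm_col_mxd m n (a : 'cV[R]_m) (b : 'cV[R]_n) : `|b| <= `|col_mx a b|.
Proof.
by apply: mx_norm_le => // i j; rewrite -(col_mxEd a b); exact: mx_norm_entry.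
Qed.

Lemma col_mx_lin m n (a : 'cV[R]_m) (b : 'cV[R]_n) :
  col_mx a b = col_mx 1%:M 0 *m a + col_mx 0 1%:M *m b.
Proof. by rewrite !mul_col_mx !mul1mx !mul0mx add_col_mx addr0 add0r. Qed.

Lemma continuous_col_mx (T : topologicalType) m n (a : T -> 'cV[R]_m) (b : T -> 'cV[R]_n) t :
  {for t, continuous a} -> {for t, continuous b} ->
  {for t, continuous (fun u => col_mx (a u) (b u))}.
Proof.
move=> ca cb.
have -> : (fun u => col_mx (a u) (b u)) =
    (fun u => col_mx 1%:M 0 *m a u) + (fun u => col_mx 0 1%:M *m b u).
  by apply/funext => u; exact: col_mx_lin.
have cl k (C : 'M[R]_(m + n, k)) (f : T -> 'cV[R]_k) : {for t, continuous f} ->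
    {for t, continuous (fun u => C *m f u)}.
  move=> cf; have cC := @mx_linear_continuous R k 1 _ (mulmx C : {linear _ -> _}).
  exact: continuous_comp cf (cC _).
exact: (continuousD (cl _ _ _ ca) (cl _ _ _ cb)).
Qed.

Lemma is_diff_col_mx (E : normedModType R) m n (a : E -> 'cV[R]_m) (b : E -> 'cV[R]_n)
    da db t :
  is_diff t a da -> is_diff t b db ->
  is_diff t (fun u => col_mx (a u) (b u)) (fun v => col_mx (da v) (db v)).
Proof.
move=> [ha <-] [hb <-].
have -> : (fun u => col_mx (a u) (b u)) =
    (fun u => col_mx 1%:M 0 *m a u) + (fun u => col_mx 0 1%:M *m b u).
  by apply/funext => u; exact: col_mx_lin.
have -> : (fun v => col_mx ('d a t v) ('d b t v)) =
    (fun u => col_mx 1%:M 0 *m 'd a t u) + (fun u => col_mx 0 1%:M *m 'd b t u).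
  by apply/funext => u; exact: col_mx_lin.
by apply: is_diffD; apply: (diff_mxlin (mulmx _ : {linear _ -> _})).
Qed.

Lemma smooth_col_mx (E : normedModType R) U m n (a : E -> 'cV[R]_m) (b : E -> 'cV[R]_n) :
  open U -> smooth_on U a -> smooth_on U b -> smooth_on U (fun u => col_mx (a u) (b u)).
Proof.
move=> oU sa sb.
have -> : (fun u => col_mx (a u) (b u)) =
    (fun u => col_mx 1%:M 0 *m a u + col_mx 0 1%:M *m b u).
  by apply/funext => u; exact: col_mx_lin.
by apply: smoothD => // k; apply: (Ck_mxlin (mulmx _ : {linear _ -> _})).
Qed.

End ColMx.

Section ProductCoordinates.
Context {R : realType} {M : manifold4 R}.
Implicit Types (phi psi eta gam : chart R M) (p q x : M) (F : set (chart R M)).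

Definition transverse phi eta (y : 'cV[R]_(2 + 2)) : 'cV[R]_2 := dsubmx (transition phi eta y).

Lemma smooth_transverse phi eta : charts phi -> charts eta ->
  smooth_on (phi @` (dom phi `&` dom eta)) (transverse phi eta).
Proof.
move=> cphi ceta k.
apply: (Ck_mxlin (dsubmx : {linear 'cV[R]_(2 + 2) -> 'cV[R]_2})).
  exact: open_transition.
exact: smooth_transition.
Qed.

(** Transversality is given in slice charts of L and of the disk; [leaf_kernel] and [leaf_tangent]
    carry it over to foliated charts. *)
Lemma foliations_transversal (J : tensor_field M) L H G phi eta gam x v :
  foliation H -> L = leaf H x -> transversal_PH_disks J L G ->
  slice_chart L phi x -> H eta -> dom eta x -> G gam -> dom gam x ->
  dsubmx ('d (transition phi gam) (phi x) v) = 0 ->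
  dsubmx ('d (transition phi eta) (phi x) v) = 0 -> v = 0.
Proof.
move=> fH LE [[fG _] _ _ disks] sl Heta deta Ggam dgam vg vh.
have [cphi dphi Lx _] := sl.
have cgam : charts gam by case: fG => + _; exact.
have [[surf _] _ DL tr] := disks x Lx.
have Dx : leaf G x x by have : [set x] x by []; rewrite -DL => -[].
have [psi slD] := surf x Dx; have [cpsi dpsi _ _] := slD.
apply: (tr phi psi sl slD).
  have slH : slice_chart (leaf H x) phi x by rewrite -LE.
  have Lx' : leaf H x x by rewrite -LE.
  by apply/(leaf_kernel v fH Heta slH Lx' deta dphi).
rewrite -(diff_transition_comp v cphi cgam cpsi dphi dgam dpsi).
exact: leaf_tangent fG Ggam slD Dx dgam dpsi vg.
Qed.

(** The inverse function theorem for the pair of transverse coordinates: a is constant on the leaves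
    of [gam], b on those of [eta], and T is the local inverse. *)
Lemma product_coordinates phi eta gam x : charts phi -> charts eta -> charts gam ->
  dom phi x -> dom eta x -> dom gam x ->
  (forall v, dsubmx ('d (transition phi gam) (phi x) v) = 0 ->
    dsubmx ('d (transition phi eta) (phi x) v) = 0 -> v = 0) ->
  exists r s : R, exists T : 'cV[R]_(2 + 2) -> 'cV[R]_(2 + 2), [/\ 0 < r, 0 < s,
    forall a b, `|a - dsubmx (gam x)| < s -> `|b - dsubmx (eta x)| < s ->
      [/\ (phi @` (dom phi `&` (dom gam `&` dom eta))) (T (col_mx a b)),
          transverse phi gam (T (col_mx a b)) = a,
          transverse phi eta (T (col_mx a b)) = b &
          {for col_mx a b, continuous T}] &
    forall y, `|y - phi x| < r ->
      [/\ (phi @` (dom phi `&` (dom gam `&` dom eta))) y,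
          `|transverse phi gam y - dsubmx (gam x)| < s,
          `|transverse phi eta y - dsubmx (eta x)| < s &
          T (col_mx (transverse phi gam y) (transverse phi eta y)) = y]].
Proof.
move=> cphi ceta cgam dphi deta dgam inj.
set U := phi @` (dom phi `&` (dom gam `&` dom eta)).
have oU : open U by apply: open_chart_image; apply: openI; exact: dom_open.
have Ux : U (phi x) by exists x.
pose Psi y := col_mx (transverse phi gam y) (transverse phi eta y).
have sPsi : smooth_on U Psi.
  apply: smooth_col_mx => // k.
    apply: Ck_sub (smooth_transverse cphi cgam k).
    by move=> _ [q [q1 [q2 q3]] <-]; exists q.
  apply: Ck_sub (smooth_transverse cphi ceta k).
  by move=> _ [q [q1 [q2 q3]] <-]; exists q.
have Psix : Psi (phi x) = col_mx (dsubmx (gam x)) (dsubmx (eta x)).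
  by rewrite /Psi /transverse !transition_crd.
have dPsi_inj v : 'd Psi (phi x) v = 0 -> v = 0.
  have [_ dE] := is_diff_col_mx (diff_dsub_transition cphi cgam dphi dgam)
    (diff_dsub_transition cphi ceta dphi deta).
  move=> dv; have E0 := etrans (esym (congr1 (@^~ v) dE)) dv.
  by have [] := eq_col_mx (etrans E0 (esym (col_mx0 _ _ _ _))); exact: inj.
have [r [s [r0 s0 rU rinj [T TP]]]] := inverse_function oU (sPsi 1%N) Ux dPsi_inj.
have cPsi : {for phi x, continuous Psi} := sPsi 0%N _ Ux.
(* The ball is shrunk until its image lies where T inverts. *)
have [r' r'0 r'P] : exists2 r' : R, 0 < r' & forall y, `|y - phi x| < r' ->
    `|y - phi x| < r /\ `|Psi y - Psi (phi x)| < s.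
  have : \forall y \near phi x, `|y - phi x| < r /\ `|Psi y - Psi (phi x)| < s.
    near=> y; split.
      by near: y; apply/nbhs_ballP; exists r => // y; rewrite -ball_normE /= distrC.
    rewrite distrC; near: y.
    by move/(@cvgrPdist_lt _ _ _ (nbhs (phi x))) : cPsi; exact.
  move=> /nbhs_ballP[r' r'0 r'P]; exists r' => // y yx; apply: r'P.
  by rewrite -ball_normE /= distrC.
exists r', s, T; split=> // [a b ax bx|y yr].
  have abs : `|col_mx a b - Psi (phi x)| < s.
    by rewrite Psix opp_col_mx add_col_mx; exact: norm_col_mx_lt.
  have [Tr TE cT] := TP _ abs.
  have [E1 E2] := eq_col_mx TE.
  by split=> //; exact: rU.
have [yr' ys] := r'P y yr.
have [Tr TE cT] := TP _ ys.
split.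
- exact: rU.
- apply: le_lt_trans ys; rewrite Psix opp_col_mx add_col_mx; exact: norm_col_mxu.
- apply: le_lt_trans ys; rewrite Psix opp_col_mx add_col_mx; exact: norm_col_mxd.
- exact: rinj.
Unshelve. all: by end_near. Qed.

End ProductCoordinates.

(** * Existence of transports along short segments of L *)

Section Transport.
Context {R : realType} {M : manifold4 R}.
Implicit Types (phi psi eta gam : chart R M) (p q x w z : M) (F : set (chart R M)).

Lemma chart_ball_nbhs phi x (r : R) : dom phi x -> 0 < r ->
  nbhs x [set w | dom phi w /\ `|phi w - phi x| < r].
Proof.
move=> dx r0; apply: filterI.
  by apply: open_nbhs_nbhs; split => //; exact: dom_open.
have B : nbhs (phi x) [set y | `|y - phi x| < r].
  by apply/nbhs_ballP; exists r => // y; rewrite -ball_normE /= distrC.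
exact: (crd_continuous dx B).
Qed.

Lemma leaf_refl F phi x : F phi -> dom phi x -> leaf F x x.
Proof.
move=> Fphi dx; apply: (@leaf_chart _ _ _ phi (fun=> x)) => //.
by apply: continuous_subspaceT => t; exact: cst_continuous.
Qed.

(** In product coordinates the transport keeps the coordinate b of a point and replaces a by that of
    the moving point of L. *)
Lemma transport_exists (J : tensor_field M) L H G phi eta gam x :
  foliation H -> (forall z, L z -> leaf H z = L) -> transversal_PH_disks J L G ->
  slice_chart L phi x -> H eta -> dom eta x -> G gam -> dom gam x ->
  exists2 r : R, 0 < r & forall y, `|y - phi x| < r -> dsubmx y = dsubmx (phi x) ->
    exists c : R -> M, exists f : M -> M,
    [/\ {within `[0, 1], continuous c}, forall t, 0 <= t <= 1 -> L (c t),
        c 0 = x & c 1 = par phi y] /\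
    [/\ transport H (leaf G (c 0)) (leaf G (c 1)) c f, f x = par phi y,
        {for x, continuous f} &
        \forall w \near x, leaf G x w -> [/\ dom eta w, dom eta (f w),
          dsubmx (eta (f w)) = dsubmx (eta w) & leaf G (par phi y) (f w)]].
Proof.
move=> fH HL trG sl Heta deta Ggam dgam; have [cphi dphi Lx slice] := sl.
have ceta : charts eta by case: fH => + _; exact.
have [[fG _] _ _ disks] := trG.
have cgam : charts gam by case: fG => + _; exact.
have LE : L = leaf H x by rewrite HL.
have [[surf _] _ _ _] := disks x Lx.
have Dx : leaf G x x := leaf_refl Ggam dgam.
have [psi slD] := surf x Dx; have [cpsi dpsi _ Dslice] := slD.
have [r1 [s [T [r10 s0 TP rP]]]] := product_coordinates cphi ceta cgam dphi deta dgam
  (fun v => foliations_transversal fH LE trG sl Heta deta Ggam dgam).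
have slH : slice_chart (leaf H x) phi x by rewrite -LE.
have [r2 r20 LP] := leaf_transverse_const fH Heta slH deta.
have [r3 r30 DP] := leaf_transverse_const fG Ggam slD dgam.
pose r := Num.min r1 r2.
have r0 : 0 < r by rewrite lt_min r10.
have rr1 t : t < r -> t < r1 by rewrite lt_min => /andP[].
have rr2 t : t < r -> t < r2 by rewrite lt_min => /andP[].
exists r => // y yr y0.
(* A segment inside the slice, so the path [par phi (l t)] stays in L. *)
pose l t : 'cV[R]_(2 + 2) := phi x + t *: (y - phi x).
have l0 : l 0 = phi x by rewrite /l scale0r addr0.
have l1 : l 1 = y by rewrite /l scale1r addrC subrK.
have lr t : 0 <= t <= 1 -> `|l t - phi x| < r.
  move=> /andP[t0 t1]; rewrite /l addrAC subrr add0r normrZ ger0_norm//.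
  by apply: le_lt_trans yr; rewrite ler_piMl.
have ld t : dsubmx (l t) = dsubmx (phi x).
  by rewrite /l linearD linearZ /= linearB /= y0 subrr scaler0 addr0.
have lP t : 0 <= t <= 1 -> exists q, [/\ dom phi q, dom gam q, dom eta q & phi q = l t].
  by move=> /lr/rr1/rP[[q [q1 [q2 q3]] qE] _ _ _]; exists q.
have lh t : 0 <= t <= 1 -> transverse phi eta (l t) = dsubmx (eta x).
  by move=> t01; have [_] := LP _ (rr2 _ (lr t t01)); exact.
pose a t := transverse phi gam (l t).
have ar t : 0 <= t <= 1 -> `|a t - dsubmx (gam x)| < s.
  by move=> t01; have [] := rP _ (rr1 _ (lr t t01)).
pose good w := dom phi w /\ `|phi w - phi x| < r.
have goodP w : good w -> [/\ dom gam w, dom eta w,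
    `|dsubmx (eta w) - dsubmx (eta x)| < s &
    T (col_mx (dsubmx (gam w)) (dsubmx (eta w))) = phi w].
  move=> [dw /rr1/rP[[q [q1 [q2 q3]] qE] _]].
  have -> : w = q by rewrite -[w](crdK dw) -qE crdK.
  by rewrite /transverse !transition_crd.
pose c t := par phi (l t).
(* The point with the disk coordinate of [c t] and the H-coordinate b. *)
pose P t b := par phi (T (col_mx (a t) b)).
have PP t b : 0 <= t <= 1 -> `|b - dsubmx (eta x)| < s ->
    [/\ dom gam (P t b), dom eta (P t b), dsubmx (gam (P t b)) = a t &
        dsubmx (eta (P t b)) = b].
  move=> t01 bs; have [[q [q1 [q2 q3]] qE] Ea Eb _] := TP _ _ (ar t t01) bs.
  rewrite /P -qE crdK//.
  by split=> //; [rewrite -[RHS]Ea|rewrite -[RHS]Eb]; rewrite -qE /transverse transition_crd.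
have cl t : {for t, continuous l} by exact: continuous_line.
have ca t : 0 <= t <= 1 -> {for t, continuous a}.
  move=> t01; have [q [q1 q2 _ qE]] := lP t t01.
  have [dW _] := diff_dsub_transition cphi cgam q1 q2; rewrite qE in dW.
  exact: continuous_comp (cl t) (differentiable_continuous dW).
have cP (S : topologicalType) (ta : S -> R) (tb : S -> 'cV[R]_2) u :
    0 <= ta u <= 1 -> `|tb u - dsubmx (eta x)| < s ->
    {for u, continuous ta} -> {for u, continuous tb} ->
    {for u, continuous (fun v => P (ta v) (tb v))}.
  move=> t01 bs cta ctb; have [[q [q1 [q2 q3]] qE] _ _ cT] := TP _ _ (ar _ t01) bs.
  have cab : {for u, continuous (fun v => col_mx (a (ta v)) (tb v))}.
    exact: (continuous_col_mx (continuous_comp cta (ca _ t01)) ctb).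
  have cpar : {for T (col_mx (a (ta u)) (tb u)), continuous (par phi)}.
    by apply: par_continuous; rewrite -qE; exists q.
  exact: (continuous_comp (continuous_comp cab cT) cpar).
have one01 : 0 <= (1 : R) <= 1 by rewrite ler01 lexx.
have zero01 : 0 <= (0 : R) <= 1 by rewrite ler01 lexx.
have xs : `|dsubmx (eta x) - dsubmx (eta x)| < s by rewrite subrr normr0.
have Pl t : 0 <= t <= 1 -> P t (dsubmx (eta x)) = c t.
  move=> t01; have [_ _ _ E] := rP _ (rr1 _ (lr t t01)).
  by rewrite /P -(lh t t01) E.
pose f w := P 1 (dsubmx (eta w)).
have ceta_at w : dom eta w -> {for w, continuous (fun w => dsubmx (eta w))}.
  move=> dw; have cd := @mx_linear_continuous R _ _ _ (dsubmx : {linear 'cV[R]_(2 + 2) -> 'cV[R]_2}).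
  exact: continuous_comp (crd_continuous dw) (cd _).
(* With a fixed, moving b from its value at x to its value at w traces a path in the leaf of G
   through the end point. *)
have leafP w : good w -> leaf G (par phi y) (f w).
  move=> /goodP[_ dw ws _].
  pose b t := dsubmx (eta x) + t *: (dsubmx (eta w) - dsubmx (eta x)).
  have bs t : 0 <= t <= 1 -> `|b t - dsubmx (eta x)| < s.
    move=> /andP[t0 t1]; rewrite /b addrAC subrr add0r normrZ ger0_norm//.
    by apply: le_lt_trans ws; rewrite ler_piMl.
  pose d t := P 1 (b t).
  have -> : par phi y = d 0 by rewrite /d /b scale0r addr0 Pl// /c l1.
  have -> : f w = d 1 by rewrite /d /b scale1r addrC subrK.
  apply: (leaf_chart Ggam) => [|t t01].
    apply: continuous_in_subspaceT => t; rewrite inE /= in_itv /= => t01.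
    have k1 : {for t, continuous (fun _ : R => 1 : R)} by exact: cst_continuous.
    have k2 : {for t, continuous b} by exact: continuous_line.
    exact: (cP _ _ _ t one01 (bs t t01) k1 k2).
  have [d1 _ d2 _] := PP 1 _ one01 (bs t t01).
  have [_ _ d4 _] := PP 1 _ one01 (bs 0 zero01).
  by rewrite d2 d4.
exists c, f; rewrite /c l0 l1 (crdK dphi); split.
  split=> [||//|//].
    apply: within_par_continuous => t; rewrite /= in_itv /= => t01.
    by split; [have [q [q1 _ _ <-]] := lP t t01; exists q|exact: cl].
  move=> t t01; have [q [q1 _ _ qE]] := lP t t01.
  by rewrite -qE crdK//; apply/(slice q q1); rewrite qE ld.
have ngood : nbhs x good by exact: chart_ball_nbhs.
have fx : f x = par phi y by rewrite /f Pl// /c l1.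
split=> //.
- exists [set w | good w /\ (dom psi w /\ `|psi w - psi x| < r3)].
    by rewrite l0 crdK//; apply: filterI => //; exact: chart_ball_nbhs.
  exists (fun w t => P t (dsubmx (eta w))); split.
  + apply: continuous_in_subspaceT => -[w t]; rewrite inE => -[[_ [gw _]] /=].
    rewrite in_itv /= => t01; have [_ dw ws _] := goodP w gw.
    have c1 : {for (w, t), continuous (snd : M * R -> R)} by exact: cvg_snd.
    have c0 : {for (w, t), continuous (fst : M * R -> M)} by exact: cvg_fst.
    have c2 : {for (w, t), continuous (fun wt : M * R => dsubmx (eta wt.1))}.
      exact: (continuous_comp c0 (ceta_at _ dw)).
    exact: (cP _ snd (fun wt : M * R => dsubmx (eta wt.1)) (w, t) t01 ws c1 c2).
  + by move=> t t01; rewrite l0 (crdK dphi) Pl.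
  + move=> w Dw [gw [pw wr3]]; have [gamw dw ws Tw] := goodP w gw.
    split=> //; last exact: leafP.
      apply: (leafwise_chart Heta) => [|t t01].
        apply: continuous_in_subspaceT => t; rewrite inE /= in_itv /= => t01.
        have k1 : {for t, continuous (id : R -> R)} by exact: cvg_id.
        have k2 : {for t, continuous (fun _ : R => dsubmx (eta w))} by exact: cst_continuous.
        exact: (cP _ _ _ t t01 ws k1 k2).
      have [_ d1 _ d2] := PP t _ t01 ws; have [_ _ _ d4] := PP 0 _ zero01 ws.
      by rewrite d2 d4.
    (* The shift starts at w because points of the disk near x have the disk coordinate of x; the
       radius r3 ensures this. *)
    have [_ DPw] := DP _ wr3.
    have gamwx : dsubmx (gam w) = dsubmx (gam x).
      by rewrite -DPw ?transition_crd//; apply/(Dslice w pw).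
    have [dw' _] := gw.
    by rewrite /P /a l0 /transverse transition_crd// -gamwx Tw crdK.
- have k1 : {for x, continuous (fun _ : M => 1 : R)} by exact: cst_continuous.
  exact: (cP _ _ _ x one01 xs k1 (ceta_at _ deta)).
- move: ngood; apply: filterS => w gw _; have [_ dw ws _] := goodP w gw.
  have [_ d1 _ d2] := PP 1 _ one01 ws.
  by split=> //; exact: leafP.
Qed.

End Transport.

(** * Constancy of e along L *)

Section ProjectionConstant.
Context {R : realType} {M : manifold4 R}.
Implicit Types (phi psi eta gam : chart R M) (p q x w z : M) (F : set (chart R M)).

Lemma is_diff_comp_at (E F G : normedModType R) (f df : E -> F) (g dg : F -> G)
    (x : E) (y : F) :
  f x = y -> is_diff x f df -> is_diff y g dg -> is_diff x (g \o f) (dg \o df).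
Proof. by move=> <-; exact: is_diff_comp. Qed.

Lemma slice_preserved (J : tensor_field M) (S : set M) phi p (v : 'cV[R]_2) :
  PH_curve J S -> slice_chart S phi p ->
  J phi p *m col_mx v 0 = col_mx (ulsubmx (J phi p) *m v) 0.
Proof.
move=> [_ pres] sl; have pr := pres _ _ sl.
have J0 : dlsubmx (J phi p) = 0.
  by apply/matrixP => i j; have := preserved_entry pr i j; rewrite !mxE.
by rewrite -{1}[J phi p]submxK J0 mul_block_col !mulmx0 mul0mx !addr0.
Qed.

(** The transverse coordinate of [eta] restricted to a slice of [phi], as a function of the
    coordinates along the slice. On a transversal disk it is a local coordinate. *)
Definition slice_map phi eta p (s : 'cV[R]_2) : 'cV[R]_2 :=
  transverse phi eta (col_mx s (dsubmx (phi p))).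

Lemma diff_slice_map phi eta p : charts phi -> charts eta -> dom phi p -> dom eta p ->
  is_diff (usubmx (phi p)) (slice_map phi eta p)
    (fun v => dsubmx ('d (transition phi eta) (phi p) (col_mx v 0))).
Proof.
move=> cphi ceta dphi deta.
pose l (s : 'cV[R]_2) : 'cV[R]_(2 + 2) := col_mx s (dsubmx (phi p)).
have d1 : is_diff (usubmx (phi p)) l (fun v => col_mx v 0).
  exact: (is_diff_col_mx (is_diff_id _) (is_diff_cst (dsubmx (phi p)) _)).
have d2 := diff_dsub_transition cphi ceta dphi deta.
have lE : l (usubmx (phi p)) = phi p by rewrite /l vsubmxK.
exact: (is_diff_comp_at lE d1 d2).
Qed.

Lemma slice_map_J (J : tensor_field M) (S : set M) H eta phi p v :
  almost_complex J -> PH_foliation J H -> H eta -> dom eta p ->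
  PH_curve J S -> slice_chart S phi p ->
  'd (slice_map phi eta p) (usubmx (phi p)) (ulsubmx (J phi p) *m v) =
  drsubmx (J eta p) *m 'd (slice_map phi eta p) (usubmx (phi p)) v.
Proof.
move=> hJ PH Heta deta PHS sl; have [cphi dphi _ _] := sl.
have ceta : charts eta by case: PH => [[+ _] _]; exact.
have [_ dE] := diff_slice_map cphi ceta dphi deta.
have E u := congr1 (@^~ u) dE; rewrite /= in E.
apply: (etrans (E _)); rewrite -(slice_preserved _ PHS sl).
rewrite (PH_foliation_transition _ hJ PH Heta cphi dphi deta).
by congr (_ *m _); exact: esym (E v).
Qed.

(** The H-coordinate on the disk at x is the one on the disk at z after f. As df commutes with J,
    the matrices e at x and at z agree on the image of the differential of this coordinate, which is
    everything by transversality. *)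
Lemma projection_constant (J : tensor_field M) L H G phi eta gam x :
  almost_complex J -> PH_foliation J H -> (forall z, L z -> leaf H z = L) ->
  transversal_PH_disks J L G -> PH_transports J L G H ->
  slice_chart L phi x -> H eta -> dom eta x -> G gam -> dom gam x ->
  exists2 r : R, 0 < r & forall y, `|y - phi x| < r -> dsubmx y = dsubmx (phi x) ->
    drsubmx (J eta (par phi y)) = drsubmx (J eta x).
Proof.
move=> hJ PH HL trG PT sl Heta deta Ggam dgam; have [cphi dphi Lx slice] := sl.
have fH : foliation H by case: PH.
have ceta : charts eta by case: fH => + _; exact.
have [r r0 rP] := transport_exists fH HL trG sl Heta deta Ggam dgam.
exists r => // y yr y0; set z := par phi y.
have [c [f [[cc cL c0 c1] [tr fx cf nf]]]] := rP y yr y0.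
have germ := nbhs_singleton (PT c f cc cL tr); rewrite c0 c1 -/z in germ.
have Lz : L z by rewrite /z -c1; apply: cL; rewrite ler01 lexx.
have [_ _ _ disks] := trG.
have [PHDx _ DLx trx] := disks x Lx; have [PHDz _ _ _] := disks z Lz.
have Dx : leaf G x x := leaf_refl Ggam dgam.
have [phi1 sl1] := PHDx.1 x Dx; have [cphi1 dphi1 _ slice1] := sl1.
have [Dfx _ PHf] := germ Dx.
have [psi sl2] := PHDz.1 _ Dfx; have [cpsi dpsi _ slice2] := sl2.
have [dg PHg] := PHf phi1 psi sl1 sl2.
rewrite fx -/z in dpsi slice2 sl2 PHg dg.
set g := (fun s : 'cV[R]_2 => _) in dg PHg.
set s0 := usubmx (phi1 x) in dg PHg.
(* In the H-coordinates of the two disks, f is the identity. *)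
have nearx : \forall w \near x, dom phi1 w -> leaf G x w ->
    slice_map psi eta z (usubmx (psi (f w))) = dsubmx (eta w).
  have ndom : nbhs x [set w | dom psi (f w)].
    have nz : nbhs (f x) (dom psi).
      by rewrite fx; apply: open_nbhs_nbhs; split => //; exact: dom_open.
    exact: cf nz.
  move: nf ndom; apply: filterS2 => w nfw dfw _ Dw.
  have [d1 d2 E Df] := nfw Dw.
  have psiE := (slice2 _ dfw).1 Df.
  by rewrite /slice_map -psiE vsubmxK /transverse transition_crd.
have imx : (phi1 @` dom phi1) (phi1 x) by exists x.
pose l s : 'cV[R]_(2 + 2) := col_mx s (dsubmx (phi1 x)).
have ls0 : l s0 = phi1 x by rewrite /l vsubmxK.
have cl : {for s0, continuous l}.
  have [dl _] := is_diff_col_mx (is_diff_id s0) (is_diff_cst (dsubmx (phi1 x)) s0).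
  exact: differentiable_continuous dl.
have nears : {near s0, slice_map psi eta z \o g =1 slice_map phi1 eta x}.
  have n1 : \forall s \near s0, (phi1 @` dom phi1) (l s).
    have n1 : nbhs (l s0) (phi1 @` dom phi1).
      by rewrite ls0; apply: open_nbhs_nbhs; split => //; exact: img_open.
    exact: cl n1.
  have n2 : \forall s \near s0, dom phi1 (par phi1 (l s)) -> leaf G x (par phi1 (l s)) ->
      slice_map psi eta z (usubmx (psi (f (par phi1 (l s))))) = dsubmx (eta (par phi1 (l s))).
    have cpl : {for s0, continuous (fun s => par phi1 (l s))}.
      have cp : {for l s0, continuous (par phi1)} by rewrite ls0; exact: par_continuous.
      exact: (continuous_comp cl cp).
    have nearx' : \forall w \near par phi1 (l s0), dom phi1 w -> leaf G x w ->
      slice_map psi eta z (usubmx (psi (f w))) = dsubmx (eta w) by rewrite ls0 crdK.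
    exact: cpl nearx'.
  move: n1 n2; apply: filterS2 => s [w dw wE] /=; rewrite -wE crdK// => E.
  have ws : par phi1 (l s) = w by rewrite -wE crdK.
  have Dw : leaf G x w by apply/(slice1 w dw); rewrite wE /l col_mxKd.
  rewrite /g -/(l s) ws E// /slice_map -/(l s) -wE.
  by rewrite /transverse transition_crd.
have dpsiz : dom psi z := dpsi.
have detaz : dom eta z.
  have [_ + _ _] := nbhs_singleton nf Dx; by rewrite fx.
have d1 := diff_slice_map cphi1 ceta dphi1 deta.
have d2 := diff_slice_map cpsi ceta dpsiz detaz.
have gs0 : g s0 = usubmx (psi z) by rewrite /g -/(l s0) ls0 crdK// fx.
have [_ dE12] := is_diff_near nears (is_diff_comp_at gs0 (differentiableP dg) d2).
have chain v : 'd (slice_map phi1 eta x) s0 v =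
    'd (slice_map psi eta z) (usubmx (psi z)) ('d g s0 v).
  have [_ dE2] := d2.
  exact: etrans (congr1 (@^~ v) dE12) (esym (congr1 (@^~ _) dE2)).
have EE v : drsubmx (J eta z) *m 'd (slice_map phi1 eta x) s0 v =
            drsubmx (J eta x) *m 'd (slice_map phi1 eta x) s0 v.
  have Ex := slice_map_J v hJ PH Heta deta PHDx sl1.
  have Ez := slice_map_J ('d g s0 v) hJ PH Heta detaz PHDz sl2.
  have E12 := congr1 ('d (slice_map psi eta z) (usubmx (psi z))) (esym (PHg v)).
  have E1 := congr1 (mulmx (drsubmx (J eta z))) (chain v).
  have E2 := chain (ulsubmx (J phi1 x) *m v).
  exact: (etrans E1 (etrans (esym Ez) (etrans E12 (etrans (esym E2) Ex)))).
(* A vector tangent to the disk and killed by dw is also tangent to L, hence zero. *)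
have junit : jac (slice_map phi1 eta x) s0 \in unitmx.
  apply: unitmx_inj => v; rewrite -jacE.
  have [_ dE1] := d1; move=> /(etrans (esym (congr1 (@^~ v) dE1))) /= E.
  pose u := 'd (transition phi1 phi) (phi1 x) (col_mx v 0).
  have uE : 'd (transition phi phi1) (phi x) u = col_mx v 0.
    exact: diff_transitionK cphi1 cphi dphi1 dphi.
  have u0 : u = 0.
    apply: (trx phi phi1 sl sl1); last by rewrite uE col_mxKd.
    have LE : L = leaf H x by rewrite HL.
    have slH : slice_chart (leaf H x) phi x by rewrite -LE.
    have Lx' : leaf H x x by rewrite -LE.
    apply/(leaf_kernel u fH Heta slH Lx' deta dphi).
    by rewrite /u diff_transition_comp.
  move: uE; rewrite u0 linear0 => /(congr1 usubmx).
  by rewrite col_mxKu => <-; rewrite linear0.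
apply: (can_inj (mulmxK junit)).
apply/matrixP => i j.
have := EE (delta_mx j 0); rewrite !jacE !mulmxA.
move=> /(congr1 (fun C : 'cV[R]_2 => C i 0)).
by rewrite !mulmx_delta_entry eqxx !mulr1.
Qed.

End ProjectionConstant.

(** * Vanishing of the Nijenhuis component *)

Section NijenhuisVanishing.
Context {R : realType} {M : manifold4 R}.
Implicit Types (phi eta : chart R M) (p q x : M).

(** The matrix e is smooth in the coordinates of [eta]; here it is composed with the transition from
    [phi]. *)
Lemma differentiable_projected (J : tensor_field M) phi eta y i j :
  almost_complex J -> charts phi -> charts eta ->
  (phi @` (dom phi `&` dom eta)) y ->
  differentiable (fun z => drsubmx (J eta (par phi z)) i j) y.
Proof.
move=> [sJ _ _] cphi ceta [q [dphi deta] <-].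
have dT := differentiableP (differentiable_transition cphi ceta dphi deta).
have etaq : (eta @` dom eta) (eta q) by exists q.
have dJ := differentiableP (smooth_differentiable (sJ eta ceta) etaq).
have [dJT _] := is_diff_comp_at (transition_crd eta dphi) dT dJ.
have dE := diff_entry (ni i) (ni j) dJT.
have qU : (phi @` (dom phi `&` dom eta)) (phi q) by exists q.
have eqU z : (phi @` (dom phi `&` dom eta)) z ->
    J eta (par eta (transition phi eta z)) (ni i) (ni j) =
    drsubmx (J eta (par phi z)) i j.
  by move=> [w [w1 w2] <-]; rewrite transition_crd// !crdK// 2!mxE.
by have [] := is_diff_near (near_open_eq (@open_transition _ _ phi eta) qU eqU) dE.
Qed.

(** [nijenhuis_projection] is applied with the H-coordinate as W and e as J. All points of the slice
    near x are covered, since the result is then differentiated along L. *)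
Lemma nijenhuis_leaf (J : tensor_field M) L phi x :
  almost_complex J -> has_PH_foliation_with_PH_transports L J -> slice_chart L phi x ->
  exists2 r : R, 0 < r & forall y, `|y - phi x| < r -> dsubmx y = dsubmx (phi x) ->
    nijenhuis (fun z => J phi (par phi z)) y = 0.
Proof.
move=> hJ [H [PH LH HL [G [trG PT]]]] sl; have [cphi dphi Lx slice] := sl.
have [eta Heta deta] := LH x Lx.
have [_ LG _ _] := trG; have [gam Ggam dgam] := LG x Lx.
have fH : foliation H by case: PH.
have ceta : charts eta by case: fH => + _; exact.
have [r r0 Jconst] := projection_constant hJ PH HL trG PT sl Heta deta Ggam dgam.
have xU : (phi @` (dom phi `&` dom eta)) (phi x) by exists x.
have [r' r'0 rU] := open_normP (@open_transition _ _ phi eta) xU.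
pose s := Num.min r r'; exists s; first by rewrite lt_min r0.
move=> y ys y0.
pose U := (phi @` (dom phi `&` dom eta)) `&` ball (phi x) s.
have oU : open U by apply: openI; [exact: open_transition|exact: ball_open].
have Uball z : ball (phi x) s z -> `|z - phi x| < r.
  by rewrite -ball_normE /= distrC lt_min => /andP[].
have Uy : U y.
  split; first by apply: rU; move: ys; rewrite lt_min => /andP[].
  by rewrite -ball_normE /= distrC.
have LE : L = leaf H x by rewrite HL.
have slH : slice_chart (leaf H x) phi x by rewrite -LE.
have dW z : U z -> exists q, [/\ dom phi q, dom eta q, phi q = z &
    forall v, 'd (transverse phi eta) z v = dsubmx ('d (transition phi eta) z v)].
  move=> [[q [q1 q2] qz] _]; exists q; split=> // v.
  have [_ dE] := diff_dsub_transition cphi ceta q1 q2.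
  by rewrite -qz; exact: (congr1 (@^~ v) dE).
have onL q : dom phi q -> dsubmx (phi q) = dsubmx y -> leaf H x q.
  by move=> q1 E; rewrite -LE; apply/(slice q q1); rewrite E.
apply: (@nijenhuis_projection R U _ (transverse phi eta)
  (fun z => drsubmx (J eta (par phi z)))) => //.
- move=> k; apply: Ck_sub (_ : Ck k (phi @` dom phi) _).
    by move=> _ [[q [q1 _] <-] _]; exists q.
  by have [sJ _ _] := hJ; exact: sJ.
- move=> k; apply: Ck_sub (smooth_transverse cphi ceta k).
  by move=> z [].
- by move=> i j; apply: differentiable_projected => //; case: Uy.
- move=> z Uz v; have [q [q1 q2 qz dE]] := dW z Uz.
  rewrite !dE -qz crdK//.
  exact: PH_foliation_transition hJ PH Heta cphi q1 q2.
- move=> z Uz zy v v0; have [q [q1 q2 qz dE]] := dW z Uz.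
  have Lq : leaf H x q by apply: onL => //; rewrite qz.
  by rewrite dE -qz; apply/(leaf_kernel v fH Heta slH Lq q2 q1).
- move=> v; have [q [q1 q2 qz dE]] := dW y Uy.
  have Lq : leaf H x q by apply: onL => //; rewrite qz.
  by rewrite dE -qz => /(leaf_kernel v fH Heta slH Lq q2 q1).
- by move=> z [_ /Uball zr] zy; rewrite !Jconst ?zy//; case: Uy => _ /Uball.
Qed.

Lemma nij_jets_eq0 (J : tensor_field M) L phi x m :
  almost_complex J -> has_PH_foliation_with_PH_transports L J -> slice_chart L phi x ->
  nij_jets (jet m (fun y => J phi (par phi y)) (phi x)) = 0.
Proof.
move=> hJ PJ sl; have [cphi dphi _ _] := sl.
have [r r0 N0] := nijenhuis_leaf hJ PJ sl.
have px : (phi @` dom phi) (phi x) by exists x.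
have oI := @img_open _ _ phi.
have sJ : smooth_on (phi @` dom phi) (fun y => J phi (par phi y)).
  by have [sJ _ _] := hJ; exact: sJ.
apply/matrixP => k j; rewrite !mxE (nij_jetE oI px sJ (ltn_ord k)).
(* The tensor vanishes only on the slice, but the line in direction [ti 0] lies in it. *)
have line0 : \forall t \near (0 : R),
    nijenhuis (fun y => J phi (par phi y)) (phi x + t *: evec (ti 0)) = cst 0 (phi x + t *: evec (ti 0)).
  have oB : open (ball (phi x) r) by exact: ball_open.
  move: (near_tangent_line 0 oB (ballxx (phi x) r0)).
  apply: filterS => t; rewrite -ball_normE /= distrC => tr.
  by apply: N0 => //; exact: dsubmx_tangent_line.
have := nbhs_singleton (iter_derive_line k line0); rewrite scale0r addr0 => ->.
have T0 l : iter l (fun g => 'D_(evec (ti 0)) g) (cst 0) = cst 0 :> ('cV[R]_(2 + 2) -> R).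
  by elim: l => //= l ->; apply/funext => y; exact: derive_cst.
by rewrite T0.
Qed.

Lemma structure_jet (J : tensor_field M) L phi x m :
  almost_complex J -> PH_curve J L -> slice_chart L phi x ->
  structure_jets L phi x m (jet m (fun y => J phi (par phi y)) (phi x)).
Proof.
move=> [sJ J2 _] [_ pres] [cphi dphi Lx slice].
exists (fun y => J phi (par phi y)), (phi @` dom phi); split => //.
- by split; [exact: img_open|exists x|].
- exact: sJ.
- by move=> _ [q dq <-]; rewrite crdK//; exact: J2.
- move=> _ [q dq <-]; rewrite crdK// => Lq; apply: pres; split=> // q' dq'.
  by rewrite (slice q' dq') (slice q dq).1.
Qed.

End NijenhuisVanishing.

Theorem proposition24 (R : realType) (M : manifold4 R) (L : set M)
  (hL : surface L) :
  codim_infinity L (has_PH_foliation_with_PH_transports L).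
Proof.
move=> x phi sl.
exists (fun m => [set j | structure_jets L phi x m j /\ nij_jets j = 0]); split.
  move=> m J hJ PHL PJ; split; first exact: (structure_jet m hJ PHL sl).
  exact: (nij_jets_eq0 m hJ PJ sl).
(* A single submanifold of codimension m is used, so the threshold for c is c itself. *)
move=> c; exists c => // m /= cm.
exists 1%N, (fun=> [set j | structure_jets L phi x m j /\ nij_jets j = 0]), (fun=> m).
by split=> [_|j Sj]; [split=> //; exact: codim_nij_jets|exists 0].
Qed.
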